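(* Let $\mathbf f=(f_n)_{n\ge 1}$ be a $\boldsymbol{\xi}$-regular infinite iterated function system on $[0,1]$ satisfying the Bounded Distortion Property. For every infinite subset $D\subseteq\mathbb N$ and any function $\varphi:\mathbb N\to[\min D,\infty)$ such that $\varphi(n)\to\infty$ as $n\to\infty$, the set $$S(\mathbf f,D,\varphi):=\{x\in\mathbb E(\mathbf f,D): a_n(x)\le\varphi(n)\text{ for all }n\in\mathbb N\}$$ satisfies $$\dim_{\mathrm H} S(\mathbf f,D,\varphi)=s_0(D;\boldsymbol{\xi}).$$
   Context: $\mathbb N=\{1,2,\dots\}$ and $\dim_{\mathrm H}$ denotes Hausdorff dimension. An infinite iterated function system (iIFS) is a sequence $\mathbf f=(f_n)_{n\ge1}$ of functions $f_n:[0,1]\to[0,1]$ such that: (i) (Smoothness) $f_n\in C^1([0,1])$ for each $n\ge1$; (ii) (Contraction) there exist an integer $q\geq 1$ and a real number $0<\rho<1$ such that for any $(a_1,\dots,a_q)\in\mathbb N^q$ and $x\in[0,1]$, $0<|(f_{a_1}\circ\cdots\circ f_{a_q})'(x)|\le\rho<1$; (iii) (Open Set Condition) for any $i\ne j$ in $\mathbb N$, $f_i((0,1))\cap f_j((0,1))=\emptyset$. The natural projection is $\Pi_{\mathbf f}:\mathbb N^{\mathbb N}\to[0,1]$, $\Pi_{\mathbf f}((a_n)_{n\ge1})=\lim_{n\to\infty}f_{a_1}\circ\cdots\circ f_{a_n}(1)$, and the attractor is $\Lambda(\mathbf f)=\Pi_{\mathbf f}(\mathbb N^{\mathbb N})$.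 To all but countably many $x\in\Lambda(\mathbf f)$ there corresponds a unique sequence $(a_n(x))_{n\ge1}\in\mathbb N^{\mathbb N}$ with $x=\lim_{n\to\infty}f_{a_1(x)}\circ\cdots\circ f_{a_n(x)}(1)$, called the sequence of digits of $x$. (For the remaining countably many points, take $(a_n(x))_{n\ge 1}$ to be any fixed choice of such a sequence; a countable set does not affect Hausdorff dimension.) The iIFS is $\boldsymbol{\xi}$-regular, where $\boldsymbol{\xi}=(\xi_n)_{n\ge1}$ is a sequence of positive numbers, if for every $\varepsilon>0$ there are constants $c_1,c_2>0$ depending on $\varepsilon$ such that $$\frac{c_1}{\xi_n^{1+\varepsilon}}\le|f_n'(x)|\le\frac{c_2}{\xi_n^{1-\varepsilon}}\quad\text{for all }n\in\mathbb N\text{ and all }x\in[0,1].$$ It satisfies the Bounded Distortion Property if there is a constant $\kappa\ge1$ such that for every $n\in\mathbb N$ and $a_1,\dots,a_n\in\mathbb N$, $|(f_{a_1}\circ\cdots\circ f_{a_n})'(x)|\le\kappa|(f_{a_1}\circ\cdots\circ f_{a_n})'(y)|$ for all $x,y\in[0,1]$. For an infinite subset $D\subseteq\mathbb N$ define $$\mathbb E(\mathbf f,D):=\{x\in\Lambda(\mathbf f): a_n(x)\in D\text{ for all }n\in\mathbb N,\ \lim_{n\to\infty}a_n(x)=\infty\},\qquad s_0(D;\boldsymbol{\xi}):=\inf\Big\{s\ge0:\sum_{n\in D}\frac1{\xi_n^s}<\infty\Big\}.$$ *)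

(* Defs.v *)
From mathcomp Require Import all_boot all_order all_algebra.
From mathcomp Require Import all_classical all_reals all_analysis.

Set Implicit Arguments.
Unset Strict Implicit.
Unset Printing Implicit Defensive.

Import Order.TTheory GRing.Theory Num.Theory.
Import numFieldNormedType.Exports.

Local Open Scope classical_set_scope.
Local Open Scope ring_scope.

(* Families indexed by {1, 2, ...} are functions on nat whose value at 0 is
   never used: all quantifications over indices and digits are guarded. *)

Section Hausdorff.
Context {R : realType}.
Implicit Types (A U : set R) (s delta : R).

(* Extended real, so that unbounded sets have diameter +oo (and set0 has
   diameter -oo); the value on set0 is overridden in [diam_pow]. *)
Definition diam U : \bar R :=
  ereal_sup [set (`|p.1 - p.2|)%:E | p in U `*` U].

(* |U|^s with |set0|^s = 0 also for s = 0, and |{x}|^0 = 1. *)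
Definition diam_pow s U : \bar R :=
  if U == set0 then 0%E else (diam U `^ s)%E.

Definition delta_cover delta A (U : nat -> set R) : Prop :=
  A `<=` \bigcup_i U i /\ forall i, (diam (U i) <= delta%:E)%E.

Definition hausdorff_content s delta A : \bar R :=
  ereal_inf [set (\sum_(0 <= i <oo) diam_pow s (U i))%E | U in delta_cover delta A].

Definition hausdorff_measure s A : \bar R :=
  ereal_sup [set hausdorff_content s delta A | delta in [set d | 0 < d]].

(* For A a subset of the line this set of exponents contains every s > 1. *)
Definition hausdorff_dim A : \bar R :=
  ereal_inf [set s%:E | s in [set s | 0 <= s /\ hausdorff_measure s A = 0%E]].

End Hausdorff.

Section IteratedFunctionSystem.
Context {R : realType}.
Implicit Types (f : nat -> R -> R) (g : R -> R) (x : R) (xi phi : nat -> R).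
Implicit Types (w : seq nat) (u : nat -> nat) (D : set nat).

(* Derivative on [0, 1], one-sided at 0 and 1: the values of g outside [0, 1]
   play no role. *)
Definition diff_quotient g x : R -> R := fun y => (g y - g x) / (y - x).

Definition derivable01 g x : Prop :=
  cvg (diff_quotient g x y @[y --> within `[0, 1] x^']).

Definition deriv01 g x : R :=
  lim (diff_quotient g x y @[y --> within `[0, 1] x^']).

Definition C1_01 g : Prop :=
  (forall x, x \in `[0, 1] -> derivable01 g x) /\
  {within `[0, 1], continuous (deriv01 g)}.

Definition posw w : Prop := all (leq 1) w.

Definition compw f w : R -> R := foldr (fun i g => f i \o g) id w.

Definition uniformly_contracting f : Prop :=
  exists (q : nat) (rho : R), [/\ (1 <= q)%N, 0 < rho < 1 &
    forall w x, posw w -> size w = q -> x \in `[0, 1] ->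
      0 < `|deriv01 (compw f w) x| <= rho].

Definition open_set_condition f : Prop :=
  forall i j, (1 <= i)%N -> (1 <= j)%N -> i <> j ->
    (f i @` `]0, 1[) `&` (f j @` `]0, 1[) = set0.

Definition iIFS f : Prop :=
  [/\ forall n x, (1 <= n)%N -> x \in `[0, 1] -> f n x \in `[0, 1],
      forall n, (1 <= n)%N -> C1_01 (f n),
      uniformly_contracting f &
      open_set_condition f].

(* The word u_1 ... u_n. *)
Definition prefix_word u (n : nat) : seq nat := [seq u k | k <- iota 1 n].

Definition digit_seq u : Prop := forall n, (1 <= n)%N -> (1 <= u n)%N.

Definition nat_proj f u : R := lim (compw f (prefix_word u n) 1 @[n --> \oo]).

Definition attractor f : set R := nat_proj f @` digit_seq.

(* [a x n] is the n-th digit of x; where a point has several codings, [a] is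
   an arbitrary choice of one of them. *)
Definition digits_of f (a : R -> nat -> nat) : Prop :=
  forall x, attractor f x -> digit_seq (a x) /\ nat_proj f (a x) = x.

Definition xi_regular xi f : Prop :=
  forall eps : R, 0 < eps -> exists c1 c2 : R, [/\ 0 < c1, 0 < c2 &
    forall n x, (1 <= n)%N -> x \in `[0, 1] ->
      c1 / xi n `^ (1 + eps) <= `|deriv01 (f n) x| <= c2 / xi n `^ (1 - eps)].

Definition bounded_distortion f : Prop :=
  exists kappa : R, 1 <= kappa /\
    forall w, w <> [::] -> posw w ->
    forall x y, x \in `[0, 1] -> y \in `[0, 1] ->
      `|deriv01 (compw f w) x| <= kappa * `|deriv01 (compw f w) y|.

Definition E_set f (a : R -> nat -> nat) D : set R :=
  [set x | [/\ attractor f x,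
               forall n, (1 <= n)%N -> D (a x n) &
               a x n @[n --> \oo] --> \oo]].

Definition S_set f (a : R -> nat -> nat) D phi : set R :=
  [set x | E_set f a D x /\ forall n, (1 <= n)%N -> (a x n)%:R <= phi n].

Definition s0 D xi : \bar R :=
  ereal_inf [set s%:E | s in
    [set s : R | 0 <= s /\ (\esum_(n in D) (1 / xi n `^ s)%:E < +oo)%E]].

Definition minN D : nat := xget 0%N (D `&` lbound D).

End IteratedFunctionSystem.

(* Main.v *)
(* Upper bound: if t < s and the sum of xi_n^-t over D converges, then, since
   f_n contracts by c xi_n^-(t/s), the contraction ratios to the power s have
   sum at most 1/2 over the large digits of D. Points whose digits tend to
   infinity in D eventually use only those digits, so that refining the cover
   of a cylinder by one generation halves its s-dimensional size.

   Lower bound: if the sum of xi_n^-t over D diverges and s < t, write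
   r_n = c xi_n^-(t/s) for the lower bound of |f_n'|. Then D contains finite
   blocks B_j in [j, oo) with a sum of r_n^s at least 2. Let the n-th digit
   range over B_J(n), with J tending to infinity so slowly that the digits are
   at most phi n and r_i >= 2^-n on B_J(n). Drawing the n-th digit i with
   probability proportional to r_i^s gives a word v of length n a mass
   O(2^-n l_v^s), where l_v, the product of the r_i, bounds the length of the
   interval f_v([0, 1]) from below. Stopping each word as soon as l_v <= 2d,
   the factor 2^-n absorbs the size of the last ratio, and disjointness of the
   intervals then bounds the mass of a ball of radius d by O(d^s). Since l_v is
   compared with d instead of the length of f_v([0, 1]), no distortion estimate
   is involved. A point with two codings is of the form f_w(0) or f_w(1), so the
   arbitrary choice of digits matters on a countable set only. *)

Require Import Defs.
From mathcomp Require Import all_boot all_order all_algebra.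
From mathcomp Require Import all_classical all_reals all_analysis.
From mathcomp Require Import ring lra.
Import Order.TTheory GRing.Theory Num.Theory.
Import numFieldNormedType.Exports.
Local Open Scope classical_set_scope.
Local Open Scope ring_scope.

Set Implicit Arguments.
Unset Strict Implicit.
Unset Printing Implicit Defensive.

(** * Hausdorff-null sets and covers *)

Section Covers.
Context {R : realType}.
Implicit Types (s d : R) (A U : set R) (eta : \bar R).

(** An explicit cover instead of the infimum in [hausdorff_content], so that covers can be glued;
    [eta] is extended real in order to accept the value of a series. *)
Definition covers s d A eta :=
  exists2 U, delta_cover d A U & (\sum_(0 <= i <oo) diam_pow s (U i) <= eta)%E.

Lemma diam_pow_ge0 s U : (0 <= diam_pow s U)%E.
Proof. by rewrite /diam_pow; case: ifP => // _; exact: poweR_ge0. Qed.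

Lemma diam_pow_set0 s : diam_pow s set0 = 0%E.
Proof. by rewrite /diam_pow eqxx. Qed.

Lemma diam_set0 : @diam R set0 = -oo%E.
Proof. by rewrite /diam set0X image_set0 ereal_sup0. Qed.

Lemma diam_ge0 U : U !=set0 -> (0 <= diam U)%E.
Proof.
by move=> [x Ux]; apply: ereal_sup_ubound; exists (x, x); rewrite //= subrr normr0.
Qed.

Lemma covers_le s d A B eta1 eta2 :
  A `<=` B -> (eta1 <= eta2)%E -> covers s d B eta1 -> covers s d A eta2.
Proof.
move=> AB le12 [U [BU dU] leU]; exists U; last exact: le_trans leU le12.
by split=> //; exact: subset_trans BU.
Qed.

Lemma covers_self s d A : (diam A <= d%:E)%E -> covers s d A (diam_pow s A).
Proof.
move=> dA; exists (fun i => if i == 0%N then A else set0).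
  split=> [x Ax|i]; first by exists 0%N.
  by case: ifP => // _; rewrite diam_set0 leNye.
rewrite nneseries_recl//; last by move=> i _; exact: diam_pow_ge0.
rewrite eqxx eseries0 ?adde0// => i; case: i => // i _ _ /=.
by rewrite diam_pow_set0.
Qed.

Lemma covers_set0 s d : covers s d set0 0.
Proof. by rewrite -(diam_pow_set0 s); apply: covers_self; rewrite diam_set0 leNye. Qed.

(** Countable subadditivity: the covers of the pieces form a doubly indexed family, flattened along
    a bijection of nat with its square. *)
Lemma covers_bigcup s d (A : nat -> set R) (eta : nat -> \bar R) :
  (forall i, covers s d (A i) (eta i)) ->
  covers s d (\bigcup_i A i) (\sum_(0 <= i <oo) eta i).
Proof.
move=> cA.
have /choice[U UP] : forall i, exists U : nat -> set R, delta_cover d (A i) U /\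
    (\sum_(0 <= j <oo) diam_pow s (U j) <= eta i)%E.
  by move=> i; have [U] := cA i; exists U.
have /card_set_bijP[e be] : ([set: nat] #= [set: nat * nat])%card.
  by rewrite card_eq_sym; exact: card_nat2.
exists (fun k => U (e k).1 (e k).2).
  split=> [x [i _ Aix]|k]; last by have [[_ dU] _] := UP (e k).1.
  have [[AU _] _] := UP i; have [j _ Ujx] := AU _ Aix.
  have [_ _ /(_ (i, j) I)[k _ ek]] := be.
  by exists k; rewrite // ek.
rewrite nneseries_esumT; last by move=> k; exact: diam_pow_ge0.
rewrite -(@reindex_esum _ _ _ _ _ _ (fun k => diam_pow s (U k.1 k.2)) be).
have -> : [set: nat * nat] = [set: nat] `*`` (fun=> [set: nat]).
  by apply/seteqP; split=> // -[].
rewrite -(@esum_esum _ _ _ _ _ (fun i j => diam_pow s (U i j))); last first.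
  by move=> *; exact: diam_pow_ge0.
rewrite -nneseries_esumT; last by move=> i; apply: esum_ge0 => j _; exact: diam_pow_ge0.
apply: lee_nneseries => i _.
  by move=> _; apply: esum_ge0 => j _; exact: diam_pow_ge0.
rewrite -nneseries_esumT; last by move=> k; exact: diam_pow_ge0.
by have [] := UP i.
Qed.

Lemma covers_setU s d A B (eta1 eta2 : \bar R) :
  (0 <= eta1)%E -> (0 <= eta2)%E ->
  covers s d A eta1 -> covers s d B eta2 -> covers s d (A `|` B) (eta1 + eta2).
Proof.
move=> eta1_ge0 eta2_ge0 cA cB.
pose eta i := if i == 0%N then eta1 else if i == 1%N then eta2 else 0%E.
have eta_ge0 i : (0 <= eta i)%E by case: i => [|[|i]].
apply: (@covers_le _ _ _
  (\bigcup_i (if i == 0%N then A else if i == 1%N then B else set0))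
  (\sum_(0 <= i <oo) eta i)%E).
- by move=> x [Ax|Bx]; [exists 0%N|exists 1%N].
- rewrite (nneseries_split 0 2)// eseries0; last first.
    by case=> [|[|i]].
  by rewrite adde0 add0n big_nat_recr//= big_nat1.
- apply: covers_bigcup => -[|[|i]] //; exact: covers_set0.
Qed.

(** A supremum of nonnegative contents vanishes iff each content does, that is, iff each infimum is
    below every positive [e]. *)
Lemma hausdorff_measure_eq0P s A : hausdorff_measure s A = 0%E <->
  (forall d e, 0 < d -> 0 < e -> covers s d A e%:E).
Proof.
have content_ge0 d : (0 <= hausdorff_content s d A)%E.
  apply: le_ereal_inf_tmp => _ [U _ <-].
  by apply: nneseries_ge0 => *; exact: diam_pow_ge0.
split=> [H0 d e d0 e0|H].
  have : (hausdorff_content s d A < e%:E)%E.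
    apply: (@le_lt_trans _ _ 0%E); last by rewrite lte_fin.
    by rewrite -H0; apply: ereal_sup_ubound; exists d.
  by move=> /ereal_inf_lt[_ [U dU <-] /ltW ltU]; exists U.
apply/eqP; rewrite eq_le; apply/andP; split.
  apply: ge_ereal_sup => _ [d d0 <-]; apply/lee_addgt0Pr => e e0.
  have [U dU leU] := H d e d0 e0; rewrite add0e.
  by apply: le_trans leU; apply: ereal_inf_lbound; exists U.
apply: le_trans (content_ge0 1) _.
by apply: ereal_sup_ubound; exists 1 => //=.
Qed.

(** Diameters at most 1 have powers that decrease in the exponent, so the same cover serves for
    [t]. *)
Lemma covers_exponent s t d A (eta : \bar R) : 0 <= s <= t -> d <= 1 ->
  covers s d A eta -> covers t d A eta.
Proof.
move=> /andP[s0 st] d1 [U [AU dU] leU]; exists U => //.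
apply: le_trans leU; apply: lee_nneseries => [i _ _|i _]; first exact: diam_pow_ge0.
rewrite /diam_pow; case: ifPn => // /set0P/diam_ge0.
move: (dU i); case: (diam _) => // r; rewrite !lee_fin => rd r0.
(* A zero diameter is treated apart because 0^0 = 1: if [t = 0] then [s = 0] too, otherwise the
   power at [t] is 0. *)
have [->|rn0] := eqVneq r 0; last first.
  by rewrite ger_powR// (le_trans rd d1) lt_neqAle eq_sym rn0 r0.
have [t0|tn0] := eqVneq t 0.
  by rewrite t0 (_ : s = 0)//; apply/le_anti; rewrite s0 -t0 st.
by rewrite powR0// powR_ge0.
Qed.

(** Singletons have [diam_pow] zero for positive [s]. This will discard the points with two
    codings. *)
Lemma covers_countable s d (p : nat -> R) e : 0 < s -> 0 < d -> 0 <= e ->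
  covers s d (range p) e%:E.
Proof.
move=> s0 d0 e0; apply: (@covers_le _ _ _ (\bigcup_i [set p i])
   (\sum_(0 <= i <oo) diam_pow s [set p i])%E).
- by move=> _ [i _ <-]; exists i.
- rewrite eseries0 ?lee_fin// => i _ _; rewrite /diam_pow ifF; last first.
    by apply/negbTE/set0P; exists (p i).
  suff -> : diam [set p i] = 0%E by rewrite poweR0r// gt_eqF.
  rewrite /diam (_ : [set _ | _ in _] = [set 0%E]) ?ereal_sup1//.
  apply/seteqP; split=> [_ [[x y] [/= -> ->] <-]|_ ->] /=.
    by rewrite subrr normr0.
  by exists (p i, p i); rewrite //= subrr normr0.
- apply: covers_bigcup => i; apply: covers_self.
  apply: ge_ereal_sup => _ [[x y] [/= -> ->] <-].
  by rewrite subrr normr0 lee_fin ltW.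
Qed.

End Covers.

(** * One-sided derivatives on the unit interval *)

Section Differentiation.
Context {R : realType}.
Implicit Types (g : R -> R) (x y : R).

Lemma near_within01_dnbhs x (P : set R) :
  (\forall y \near within `[0, 1] x^', P y) <->
  (\forall y \near x, y != x -> 0 <= y <= 1 -> P y).
Proof. by []. Qed.

Lemma is_derive_deriv01 g x : 0 < x < 1 -> derivable01 g x ->
  is_derive x 1 g (deriv01 g x).
Proof.
move=> /andP[x0 x1] /(@cvgrPdist_lt _ _) gx.
apply/is_derive1_caratheodory.
(* Carathéodory's slope function; near an interior [x] the restriction to [0, 1] is no
   constraint. *)
exists (fun z => if z == x then deriv01 g x else diff_quotient g x z); split.
- move=> z; case: eqP => [->|/eqP zx]; first by rewrite !subrr mulr0.
  by rewrite /diff_quotient divfK// subr_eq0.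
- apply/cvgrPdist_lt => e /[dup] e0 /gx /near_within01_dnbhs gxe.
  have y01 : \forall y \near x, 0 <= y <= 1.
    by near=> y; apply/andP; split; near: y; [exact: lt_le_nbhsr|exact: lt_le_nbhsl].
  apply: filterS2 y01 gxe => y y01 gxe; rewrite eqxx.
  by case: ifPn => [_|yx]; [rewrite subrr normr0|exact: gxe].
- by rewrite eqxx.
Unshelve. all: by end_near. Qed.

Lemma derivable01_continuous g :
  (forall x, x \in `[0, 1] -> derivable01 g x) -> {within `[0, 1], continuous g}.
Proof.
move=> dg; apply/subspace_continuousP => x x01.
apply/cvgrPdist_lt => e e0.
suff : \forall y \near x, y != x -> 0 <= y <= 1 -> `|g x - g y| < e.
  apply: filterS => y gxy; rewrite /= in_itv /= => y01.
  by have [->|yx] := eqVneq y x; [rewrite subrr normr0|exact: gxy].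
apply/near_within01_dnbhs.
(* Away from [x] this product is [g y - g x], and it tends to 0. *)
have : (diff_quotient g x y * (y - x) @[y --> within `[0, 1] x^'] -->
    deriv01 g x * (x - x)).
  apply: cvgM; first exact: dg.
  apply: cvgB; last exact: cvg_cst.
  apply: cvg_within_filter; exact: nbhs_dnbhs.
rewrite subrr mulr0 => /cvgrPdist_lt/(_ _ e0)/near_within01_dnbhs h.
apply/near_within01_dnbhs; apply: filterS h => y + yx y01 => /(_ yx y01).
by rewrite sub0r normrN /diff_quotient divfK ?subr_eq0// distrC.
Qed.

Lemma MVT01 g (dg : R -> R) x y : {within `[0, 1], continuous g} ->
  (forall z : R, 0 < z < 1 -> is_derive z 1 g (dg z)) ->
  0 <= x -> x < y -> y <= 1 ->
  exists2 z : R, 0 < z < 1 & g y - g x = dg z * (y - x).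
Proof.
move=> cg dgE x0 xy y1.
have [z||z] := @MVT _ g dg _ _ xy.
- rewrite in_itv/= => /andP[xz zy]; apply: dgE.
  by rewrite (le_lt_trans x0)// (lt_le_trans zy).
- apply: continuous_subspaceW cg => z; rewrite /= !in_itv/= => /andP[xz zy].
  by rewrite (le_trans x0)// (le_trans zy).
- rewrite in_itv/= => /andP[xz zy] ->; exists z => //.
  by rewrite (le_lt_trans x0)// (lt_le_trans zy).
Qed.

Lemma dist_le_deriv01 g (dg : R -> R) (K : R) x y :
  {within `[0, 1], continuous g} ->
  (forall z : R, 0 < z < 1 -> is_derive z 1 g (dg z)) ->
  (forall z : R, 0 < z < 1 -> `|dg z| <= K) ->
  0 <= x <= 1 -> 0 <= y <= 1 -> `|g x - g y| <= K * `|x - y|.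
Proof.
move=> cg dgE dgK; wlog xy : x y / x < y.
  move=> H x01 y01; have [xy|yx|->] := ltgtP x y; first exact: H.
    by rewrite distrC (distrC x); exact: H.
  by rewrite !subrr normr0 mulr0.
move=> /andP[x0 _] /andP[_ y1]; have [z z01 E] := MVT01 cg dgE x0 xy y1.
by rewrite distrC E (distrC x) normrM ler_wpM2r// dgK.
Qed.

Lemma dist_ge_deriv01 g (dg : R -> R) (k : R) x y :
  {within `[0, 1], continuous g} ->
  (forall z : R, 0 < z < 1 -> is_derive z 1 g (dg z)) ->
  (forall z : R, 0 < z < 1 -> k <= `|dg z|) ->
  0 <= x <= 1 -> 0 <= y <= 1 -> k * `|x - y| <= `|g x - g y|.
Proof.
move=> cg dgE dgk; wlog xy : x y / x < y.
  move=> H x01 y01; have [xy|yx|->] := ltgtP x y; first exact: H.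
    by rewrite distrC (distrC (g x)); exact: H.
  by rewrite !subrr normr0 mulr0.
move=> /andP[x0 _] /andP[_ y1]; have [z z01 E] := MVT01 cg dgE x0 xy y1.
by rewrite (distrC (g x)) E (distrC x) normrM ler_wpM2r// dgk.
Qed.

(* An interior value 0 or 1 would be an extremum, hence a critical point. *)
Lemma interior_image01 g (dg : R -> R) x :
  (forall z : R, 0 <= z <= 1 -> 0 <= g z <= 1) ->
  (forall z : R, 0 < z < 1 -> is_derive z 1 g (dg z)) ->
  (forall z : R, 0 < z < 1 -> dg z != 0) ->
  0 < x < 1 -> 0 < g x < 1.
Proof.
move=> g01 dgE dgN0 x01.
have D t : t \in `]0, 1[ -> derivable g t 1.
  by rewrite in_itv/= => /dgE[].
have xI : x \in `]0, 1[ by rewrite in_itv.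
have g01' t : t \in `]0, 1[ -> 0 <= g t <= 1.
  by rewrite in_itv/= => /andP[t0 t1]; apply: g01; rewrite !ltW.
have nd : ~ is_derive x 1 g 0.
  move=> g'x; have := dgN0 x x01; have [_ <-] := dgE x x01; case: g'x => _ ->.
  by rewrite eqxx.
have /andP[gx0 gx1] := g01' x xI.
rewrite !lt_neqAle gx0 gx1 !andbT; apply/andP; split; apply/eqP => E; apply: nd.
  by apply: (derive1_at_min ler01 D xI) => t /g01' /andP[]; rewrite -E.
by apply: (derive1_at_max ler01 D xI) => t /g01' /andP[]; rewrite E.
Qed.

(** The closed interval is mapped onto the segment between the endpoint values, and injectivity
    keeps interior points off these values. Images of words thus become intervals of known
    length. *)
Lemma image_oo01 g :
  {within `[0, 1], continuous g} ->
  (forall x y : R, 0 <= x <= 1 -> 0 <= y <= 1 -> g x = g y -> x = y) ->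
  g @` `]0, 1[ = `]Num.min (g 0) (g 1), Num.max (g 0) (g 1)[%classic.
Proof.
move=> cg ig.
have ig' : {in `[0, 1] &, injective g}.
  by move=> x y; rewrite !in_itv/=; exact: ig.
have E := continuous_inj_image_segment ler01 cg ig'.
have imP y : (exists2 t, 0 <= t <= 1 & g t = y) <->
    Num.min (g 0) (g 1) <= y <= Num.max (g 0) (g 1).
  split=> [[t t01 gt]|yI].
    have : (g @` `[0, 1]) y by exists t; rewrite //= in_itv.
    by rewrite E /= in_itv.
  have : (g @`[0, 1])%classic y by rewrite /= in_itv.
  by rewrite -E => -[t]; rewrite /= in_itv/=; exists t.
apply/seteqP; split=> [_ [t t01 <-]|y]; rewrite /= in_itv/=.
  move: t01; rewrite /= in_itv/= => /andP[t0 t1].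
  have t01 : 0 <= t <= 1 by rewrite !ltW.
  have /imP/andP[gm gM] : exists2 u, 0 <= u <= 1 & g u = g t by exists t.
  have gt0 : g t != g 0.
    by apply: contraTneq t0 => /ig ->; rewrite ?ltxx ?lexx ?ler01.
  have gt1 : g t != g 1.
    by apply: contraTneq t1 => /ig ->; rewrite ?ltxx ?lexx ?ler01.
  rewrite !lt_neqAle gm gM !andbT; apply/andP; split.
    by rewrite minEle; case: ifP => _; rewrite eq_sym.
  by rewrite maxEle; case: ifP.
move=> /andP[my yM]; have /imP[t /andP[t0 t1] gt] :
  Num.min (g 0) (g 1) <= y <= Num.max (g 0) (g 1) by rewrite !ltW.
have nextremal u : y = g u -> u = 0 \/ u = 1 -> False.
  move=> yu [] ue; move: my yM; rewrite yu ue gt_min lt_max !ltxx ?orbF /=.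
    by move=> /lt_trans/[apply]; rewrite ltxx.
  by move=> /[swap] /lt_trans/[apply]; rewrite ltxx.
exists t => //; rewrite in_itv/= !lt_neqAle t0 t1 !andbT.
apply/andP; split; apply/eqP => te; apply: (nextremal t) => //; first by left.
by right.
Qed.

End Differentiation.

(** * Compositions along finite words *)

Section Words.
Context {R : realType}.
Variable f : nat -> R -> R.
Implicit Types (w : seq nat) (x y : R) (u : nat -> nat) (K r : nat -> R).

Lemma deriv01_is_derive (g : R -> R) x d : 0 < x < 1 ->
  is_derive x 1 g d -> deriv01 g x = d.
Proof.
move=> /andP[x0 x1] /is_derive1_caratheodory[h [gE hc <-]].
have y01 : \forall y \near x, 0 <= y <= 1.
  by near=> y; apply/andP; split; near: y; [exact: lt_le_nbhsr|exact: lt_le_nbhsl].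
(* Needed for uniqueness of the limit that defines [deriv01]. *)
have FF : ProperFilter (within `[0, 1] x^').
  apply: Build_ProperFilter_ex => P /near_within01_dnbhs nP.
  apply: (@filter_ex _ x^' _ P).
  by apply: filterS2 nP y01 => y + y01 yx; exact.
suff dx : diff_quotient g x y @[y --> within `[0, 1] x^'] --> h x.
  exact/cvg_lim.
apply/cvgrPdist_lt => e e0; apply/near_within01_dnbhs.
move/cvgrPdist_lt : hc => /(_ e e0); apply: filterS => y hy yx _.
by rewrite /diff_quotient gE mulfK// subr_eq0.
Unshelve. all: by end_near. Qed.

Lemma compw_cat w1 w2 x : compw f (w1 ++ w2) x = compw f w1 (compw f w2 x).
Proof. by elim: w1 => //= i w1 IH; rewrite IH. Qed.

Lemma compw_rcons w i x : compw f (rcons w i) x = compw f w (f i x).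
Proof. by elim: w => //= j w ->. Qed.

Lemma prefix_wordD u n m :
  prefix_word u (n + m) = prefix_word u n ++ [seq u k | k <- iota n.+1 m].
Proof. by rewrite /prefix_word iotaD map_cat add1n. Qed.

Lemma prefix_wordS u n : prefix_word u n.+1 = rcons (prefix_word u n) (u n.+1).
Proof. by rewrite -[in LHS]addn1 prefix_wordD cats1. Qed.

Lemma size_prefix_word u n : size (prefix_word u n) = n.
Proof. by rewrite size_map size_iota. Qed.

Lemma posw_prefix_word u n : digit_seq u -> posw (prefix_word u n).
Proof.
by move=> u1; rewrite /posw all_map; apply/allP => k; rewrite mem_iota => /andP[/u1 uk _].
Qed.

Hypothesis f01 : forall n (x : R), (1 <= n)%N -> 0 <= x <= 1 -> 0 <= f n x <= 1.

Lemma compw01 w x : posw w -> 0 <= x <= 1 -> 0 <= compw f w x <= 1.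
Proof. by elim: w => //= i w IH /andP[i1 w1] x01; exact/(f01 i1)/IH. Qed.

Lemma compw_lipschitz K w x y :
  (forall n (x y : R), (1 <= n)%N -> 0 <= x <= 1 -> 0 <= y <= 1 ->
    `|f n x - f n y| <= K n * `|x - y|) -> (forall n, 0 <= K n) ->
  posw w -> 0 <= x <= 1 -> 0 <= y <= 1 ->
  `|compw f w x - compw f w y| <= (\prod_(i <- w) K i) * `|x - y|.
Proof.
move=> fK K0 + x01 y01; elim: w => [|i w IH] /=.
  by rewrite big_nil mul1r.
move=> /andP[i1 w1]; rewrite big_cons -mulrA.
apply: le_trans (fK _ _ _ i1 (compw01 w1 x01) (compw01 w1 y01)) _.
by rewrite ler_wpM2l// IH.
Qed.

Lemma compw_expansion r w x y :
  (forall n (x y : R), (1 <= n)%N -> 0 <= x <= 1 -> 0 <= y <= 1 ->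
    r n * `|x - y| <= `|f n x - f n y|) -> (forall n, 0 <= r n) ->
  posw w -> 0 <= x <= 1 -> 0 <= y <= 1 ->
  (\prod_(i <- w) r i) * `|x - y| <= `|compw f w x - compw f w y|.
Proof.
move=> fr r0 + x01 y01; elim: w => [|i w IH] /=.
  by rewrite big_nil mul1r.
move=> /andP[i1 w1]; rewrite big_cons -mulrA.
apply: le_trans _ (fr _ _ _ i1 (compw01 w1 x01) (compw01 w1 y01)).
by rewrite ler_wpM2l// IH.
Qed.


Hypothesis f_inj : forall n (x y : R), (1 <= n)%N -> 0 <= x <= 1 -> 0 <= y <= 1 ->
  f n x = f n y -> x = y.

Lemma compw_inj w x y : posw w -> 0 <= x <= 1 -> 0 <= y <= 1 ->
  compw f w x = compw f w y -> x = y.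
Proof.
move=> + x01 y01; elim: w => //= i w IH /andP[i1 w1] /f_inj E.
by apply: IH => //; apply: E => //; exact: compw01.
Qed.

Hypothesis f_oo01 : forall n x, (1 <= n)%N -> 0 < x < 1 -> 0 < f n x < 1.

Lemma compw_oo01 w x : posw w -> 0 < x < 1 -> 0 < compw f w x < 1.
Proof. by elim: w => //= i w IH /andP[i1 w1] x01; exact/(f_oo01 i1)/IH. Qed.

Hypothesis f_derivable : forall n x, (1 <= n)%N -> 0 < x < 1 ->
  derivable (f n) x 1.

(** All intermediate points stay in the open interval by [compw_oo01], so the two-sided chain rule
    applies at each letter. *)
Lemma compw_derivable w x : posw w -> 0 < x < 1 -> derivable (compw f w) x 1.
Proof.
elim: w => [_ _|i w IH /andP[i1 w1] x01] /=; first exact: derivable_id.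
have /derivableP D1 := f_derivable i1 (compw_oo01 w1 x01).
have /derivableP D2 := IH w1 x01.
by have [] := is_derive1_comp D1 D2.
Qed.

End Words.

(** * Codings *)

Section Coding.
Context {R : realType}.
Variable f : nat -> R -> R.
Hypothesis f_iIFS : iIFS f.
Hypothesis f_crit : forall n (x : R), (1 <= n)%N -> 0 < x < 1 -> deriv01 (f n) x != 0.
Implicit Types (w : seq nat) (x y : R) (u : nat -> nat).

Lemma ifs_in01 n x : (1 <= n)%N -> 0 <= x <= 1 -> 0 <= f n x <= 1.
Proof.
by have [H _ _ _] := f_iIFS; move=> n1 x01; have := H n x n1; rewrite !in_itv/=; exact.
Qed.

Lemma ifs_continuous n : (1 <= n)%N -> {within `[0, 1], continuous (f n)}.
Proof. by have [_ H _ _] := f_iIFS => /H[dg _]; exact: derivable01_continuous. Qed.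

Lemma ifs_is_derive n x : (1 <= n)%N -> 0 < x < 1 ->
  is_derive x 1 (f n) (deriv01 (f n) x).
Proof.
have [_ H _ _] := f_iIFS => /H[dg _] /[dup] x01 /andP[x0 x1].
by apply: is_derive_deriv01 => //; apply: dg; rewrite in_itv/= !ltW.
Qed.

Lemma ifs_oo01 n x : (1 <= n)%N -> 0 < x < 1 -> 0 < f n x < 1.
Proof.
move=> n1; apply: (@interior_image01 _ (f n) (deriv01 (f n))).
- by move=> z; exact: ifs_in01.
- by move=> z; exact: ifs_is_derive.
- by move=> z; exact: f_crit.
Qed.

(** Rolle: two equal values would produce an interior critical point. *)
Lemma ifs_inj n x y : (1 <= n)%N -> 0 <= x <= 1 -> 0 <= y <= 1 ->
  f n x = f n y -> x = y.
Proof.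
move=> n1; wlog xy : x y / x < y.
  move=> H x01 y01; have [xy|yx|//] := ltgtP x y; first exact: H.
  by move=> /esym E; apply/esym/H.
move=> /andP[x0 _] /andP[_ y1] E.
have [z z01] := MVT01 (ifs_continuous n1) (fun z => @ifs_is_derive n z n1) x0 xy y1.
move/eqP; rewrite E subrr eq_sym mulf_eq0 (negbTE (f_crit n1 z01)) subr_eq0.
by move/eqP.
Qed.

Lemma compw_continuous w : posw w -> {within `[0, 1], continuous (compw f w)}.
Proof.
elim: w => [_|i w IH /andP[i1 w1]] /=.
  by apply: continuous_subspaceT => x; exact: cvg_id.
have fi := iffLR (subspace_continuousP _ _) (ifs_continuous i1).
have cw := iffLR (subspace_continuousP _ _) (IH w1).
apply/subspace_continuousP => x x01.
have wx01 : (`[0, 1]%classic : set R) (compw f w x).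
  by move: x01; rewrite /= !in_itv/=; exact: (compw01 ifs_in01).
apply: cvg_trans (fi _ wx01) => P /= fP.
have : nbhs x (fun y => `[0, 1]%classic y -> `[0, 1]%classic (compw f w y) ->
  P (f i (compw f w y))) := cw x x01 _ fP.
apply: filterS => y /= + y01; apply => //.
by move: y01; rewrite !in_itv/=; exact: (compw01 ifs_in01).
Qed.

(** By the mean value theorem each full block of [q] letters contributes a factor [rho]; the fewer
    than [q] letters left over merely preserve [0, 1]. *)
Lemma compw_contraction : exists q (rho : R), [/\ (0 < q)%N, 0 < rho < 1 &
  forall w x y, posw w -> 0 <= x <= 1 -> 0 <= y <= 1 ->
    `|compw f w x - compw f w y| <= rho ^+ (size w %/ q)].
Proof.
have [_ _ [q [rho [q1 rho01 ctr]]] _] := f_iIFS.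
exists q, rho; split=> // w x y.
have [k] := ubnP (size w); elim: k => // k IH in w *.
rewrite ltnS => wk w1 x01 y01.
have [wq|qw] := ltnP (size w) q.
  rewrite divn_small// expr0.
  have /andP[? ?] := compw01 ifs_in01 w1 x01.
  have /andP[? ?] := compw01 ifs_in01 w1 y01.
  by rewrite ler_norml; lra.
have [t1 d1] : posw (take q w) /\ posw (drop q w).
  by apply/andP; rewrite -all_cat cat_take_drop.
have tq : size (take q w) = q by rewrite size_takel.
rewrite -(cat_take_drop q w) !compw_cat.
have x01' := compw01 ifs_in01 d1 x01; have y01' := compw01 ifs_in01 d1 y01.
have D (z : R) : 0 < z < 1 ->
    is_derive z 1 (compw f (take q w)) (deriv01 (compw f (take q w)) z).
  move=> z01; have dz : derivable (compw f (take q w)) z 1.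
    apply: compw_derivable => //; first exact: ifs_oo01.
    by move=> n t n1 t01; have [] := ifs_is_derive n1 t01.
  by rewrite (deriv01_is_derive z01 (derivableP dz)); exact/derivableP.
have B (z : R) : 0 < z < 1 -> `|deriv01 (compw f (take q w)) z| <= rho.
  move=> /andP[z0 z1].
  have zI : z \in `[0, 1] by rewrite in_itv/= !ltW.
  by have /andP[] := ctr _ z t1 tq zI.
apply: le_trans (dist_le_deriv01 (compw_continuous t1) D B x01' y01') _.
rewrite size_cat tq divnDl// divnn q1 exprS ler_wpM2l//; first by case/andP: rho01 => /ltW.
apply: IH => //; rewrite size_drop; apply: leq_trans wk.
by rewrite ltn_subrL q1 (leq_trans q1 qw).
Qed.

Lemma compw_prefix_image u n m x : digit_seq u -> (n <= m)%N -> 0 <= x <= 1 ->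
  exists2 y, 0 <= y <= 1 & compw f (prefix_word u m) x = compw f (prefix_word u n) y.
Proof.
move=> u1 nm x01; rewrite -(subnKC nm) prefix_wordD compw_cat.
set v := map _ _; exists (compw f v x) => //.
apply: (compw01 ifs_in01) => //; rewrite /v /posw all_map.
by apply/allP => k; rewrite mem_iota => /andP[nk _]; apply: u1; exact: leq_trans nk.
Qed.

Lemma nat_proj_cvg u : digit_seq u ->
  compw f (prefix_word u n) 1 @[n --> \oo] --> nat_proj f u.
Proof.
move=> u1; apply/cauchy_cvgP/cauchy_exP => e e0.
have [q [rho [q0 /andP[rho0 rho1] ctr]]] := compw_contraction.
have [k ke] : exists k, rho ^+ k < e.
  have : rho ^+ k @[k --> \oo] --> 0 by apply: cvg_expr; rewrite ger0_norm// ltW.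
  move=> /cvgrPdist_lt/(_ e e0) => -[k _ /(_ k (leqnn k))] /=.
  by rewrite sub0r normrN ger0_norm ?exprn_ge0 ?(ltW rho0)//; exists k.
(* All later approximations lie in the image of [0, 1] under the prefix of length [k * q], whose
   diameter is at most [rho ^+ k]. *)
exists (compw f (prefix_word u (k * q)) 1).
exists (k * q)%N => // m /= km.
have o01 : 0 <= (1 : R) <= 1 by rewrite ler01 lexx.
have [y y01 ->] := compw_prefix_image u1 km o01.
apply: le_lt_trans ke; apply: le_trans (ctr _ _ _ _ o01 y01) _.
  exact: posw_prefix_word.
by rewrite size_prefix_word mulnK.
Qed.

(** The image of [0, 1] under the prefix is compact, hence closed, and contains all later
    approximations, so it contains their limit. *)
Lemma nat_proj_prefix u n : digit_seq u ->
  exists2 y, 0 <= y <= 1 & nat_proj f u = compw f (prefix_word u n) y.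
Proof.
move=> u1; set g := compw f _.
suff : (g @` `[0, 1]) (nat_proj f u).
  by move=> [y]; rewrite /= in_itv/=; exists y.
have gc : closed (g @` `[0, 1]).
  apply: compact_closed; first exact: Rhausdorff.
  apply: continuous_compact; last exact: segment_compact.
  by apply: compw_continuous; exact: posw_prefix_word.
apply: (closed_cvg _ gc _ _ (nat_proj_cvg u1)).
exists n => // m /= nm.
have [|y y01 E] := @compw_prefix_image u n m 1 u1 nm; first by rewrite ler01 lexx.
by exists y; rewrite ?in_itv// -E.
Qed.

Lemma eq_prefix_word u v n : (forall k, (1 <= k <= n)%N -> u k = v k) ->
  prefix_word u n = prefix_word v n.
Proof.
move=> uv; apply/eq_in_map => k; rewrite mem_iota add1n ltnS; exact: uv.
Qed.

(* The first index where two codings of a point differ yields two level-one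
   intervals with a common point, which must be an endpoint of one of them. *)
Lemma nat_proj_inj u v : digit_seq u -> digit_seq v ->
  nat_proj f u = nat_proj f v ->
  (forall n, (1 <= n)%N -> u n = v n) \/
  exists w (b : bool), nat_proj f u = compw f w b%:R.
Proof.
move=> u1 v1 uv.
have [?|/existsNP[n0 /not_implyP[n01 /eqP un0]]] :=
  pselect (forall n, (1 <= n)%N -> u n = v n).
  by left.
right.
have exn : exists n, (1 <= n)%N && (u n != v n) by exists n0; rewrite n01.
(* The first difference is at index [n.+1]; the common prefix of length [n] is injective and will be
   cancelled. *)
case: (ex_minnP exn) => -[//|n] /= unv nmin.
have E : prefix_word v n = prefix_word u n.
  apply: eq_prefix_word => k /andP[k1 kn]; apply/esym/eqP/negPn/negP => ukv.
  by have := nmin k; rewrite k1 ukv => /(_ isT); rewrite leqNgt ltnS kn.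
have w1 := posw_prefix_word n u1.
have [y y01 Ey] := nat_proj_prefix n.+1 u1.
have [z z01 Ez] := nat_proj_prefix n.+1 v1.
have [y_oo|] := boolP (0 < y < 1); last first.
  move: y01; rewrite !le_eqVlt => /andP[/predU1P[y0 _|y0 /predU1P[y1|y1]]].
  - by exists (prefix_word u n.+1), false; rewrite Ey -y0.
  - by exists (prefix_word u n.+1), true; rewrite Ey y1.
  - by rewrite y0 y1.
have [z_oo|] := boolP (0 < z < 1); last first.
  move: z01; rewrite !le_eqVlt => /andP[/predU1P[z0 _|z0 /predU1P[z1|z1]]].
  - by exists (prefix_word v n.+1), false; rewrite uv Ez -z0.
  - by exists (prefix_word v n.+1), true; rewrite uv Ez z1.
  - by rewrite z0 z1.
have fy01 := ifs_in01 (u1 n.+1 isT) y01.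
have fz01 := ifs_in01 (v1 n.+1 isT) z01.
exfalso; move: uv; rewrite Ey Ez !prefix_wordS E !compw_rcons.
move=> /(compw_inj ifs_in01 ifs_inj w1 fy01 fz01) fyz.
have [_ _ _ osc] := f_iIFS.
have : (f (u n.+1) @` `]0, 1[ `&` f (v n.+1) @` `]0, 1[) (f (u n.+1) y).
  split; first by exists y; rewrite //= in_itv.
  by exists z; rewrite //= in_itv.
by rewrite (osc _ _ (u1 n.+1 isT) (v1 n.+1 isT) (elimN eqP unv)).
Qed.

Lemma compw_image_oo w : posw w -> compw f w @` `]0, 1[ =
  `]Num.min (compw f w 0) (compw f w 1), Num.max (compw f w 0) (compw f w 1)[%classic.
Proof.
move=> w1; apply: image_oo01; first exact: compw_continuous.
move=> x y x01 y01; exact: (compw_inj ifs_in01 ifs_inj).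
Qed.

Lemma compw_image_rcons w i : posw w -> (1 <= i)%N ->
  compw f (rcons w i) @` `]0, 1[ `<=` compw f w @` `]0, 1[.
Proof.
move=> w1 i1 _ [x x01 <-]; rewrite compw_rcons; exists (f i x) => //.
by move: x01; rewrite /= !in_itv/=; exact: ifs_oo01.
Qed.

(** Cancelling the injective prefix [w] reduces the claim to the open set condition. *)
Lemma compw_image_disjoint w i j : posw w -> (1 <= i)%N -> (1 <= j)%N -> i <> j ->
  compw f (rcons w i) @` `]0, 1[ `&` compw f (rcons w j) @` `]0, 1[ = set0.
Proof.
move=> w1 i1 j1 ij; apply/seteqP; split=> // _ [[x x01 <-] [y y01]].
rewrite !compw_rcons.
have sub (z : R) : z \in `]0, 1[ -> 0 <= z <= 1.
  by rewrite in_itv/= => /andP[z0 z1]; rewrite !ltW.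
move/(compw_inj ifs_in01 ifs_inj w1).
move=> /(_ (ifs_in01 j1 (sub _ y01)) (ifs_in01 i1 (sub _ x01))) fyx.
have [_ _ _ /(_ i j i1 j1 ij)] := f_iIFS.
rewrite -subset0 => /(_ (f i x)); apply.
by split; [exists x|rewrite -fyx; exists y].
Qed.

End Coding.

(** * Upper bound *)

Section UpperBound.
Context {R : realType}.
Variables (f : nat -> R -> R) (K : nat -> R) (s : R) (P : pred nat).
Hypothesis f_iIFS : iIFS f.
Hypothesis f_crit : forall n (x : R), (1 <= n)%N -> 0 < x < 1 -> deriv01 (f n) x != 0.
Hypothesis f_lip : forall n (x y : R), (1 <= n)%N -> 0 <= x <= 1 -> 0 <= y <= 1 ->
  `|f n x - f n y| <= K n * `|x - y|.
Hypothesis K_ge0 : forall n, 0 <= K n.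
Hypothesis s_gt0 : 0 < s.
Hypothesis P_sum : (\sum_(0 <= i <oo | P i) (K i `^ s)%:E <= (2^-1)%:E)%E.
Implicit Types (w : seq nat) (d e : R).

(** The digits after [w] are confined to [P], while [w] itself is free: it absorbs the finitely many
    early digits outside [P]. *)
Definition cylinder w : set R := [set nat_proj f u | u in
  [set u | [/\ digit_seq u, prefix_word u (size w) = w &
               forall n, (size w < n)%N -> P (u n)]]].

Let L w := \prod_(i <- w) K i.

Let L_ge0 w : 0 <= L w.
Proof. exact: prodr_ge0. Qed.

Lemma diam_pow_le (A : set R) d : (diam A <= d%:E)%E -> (diam_pow s A <= (d `^ s)%:E)%E.
Proof.
move=> Ad; rewrite /diam_pow; case: ifPn => [_|/set0P/diam_ge0 A0].
  by rewrite lee_fin powR_ge0.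
have d0 : (0 <= d%:E)%E by exact: le_trans Ad.
rewrite -poweR_EFin; apply: gt0_ler_poweR => //; first exact: ltW.
  by rewrite in_itv/= A0 leey.
by rewrite in_itv/= d0 leey.
Qed.

Lemma cylinder_diam w : posw w -> (diam (cylinder w) <= (L w)%:E)%E.
Proof.
move=> w1; apply: ge_ereal_sup => _ [[_ _] [[u [u1 uw _] <-] [v [v1 vw _] <-]] <-] /=.
rewrite lee_fin.
have [x x01 ->] := nat_proj_prefix f_iIFS f_crit (size w) u1.
have [y y01 ->] := nat_proj_prefix f_iIFS f_crit (size w) v1.
rewrite uw vw.
apply: le_trans (compw_lipschitz (ifs_in01 f_iIFS) f_lip K_ge0 w1 x01 y01) _.
rewrite -[leRHS]mulr1 ler_wpM2l ?L_ge0// ler_norml.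
by move: x01 y01 => /andP[? ?] /andP[? ?]; lra.
Qed.

(** Covers by the descendants [k] generations below [w]: each generation halves the total by
    [P_sum]. The inequality assumed passes to the children and at generation 0 says that [L w <= d],
    which controls the diameters. *)
Lemma cylinder_covers k w d : posw w -> 0 <= d ->
  L w `^ s * 2^-1 ^+ k <= d `^ s ->
  covers s d (cylinder w) (L w `^ s * 2^-1 ^+ k)%:E.
Proof.
elim: k w => [|k IH] w w1 d0.
  rewrite expr0 mulr1 => Ld.
  have {}Ld : L w <= d.
    rewrite leNgt; apply: contraTN Ld => dL; rewrite -ltNge.
    by apply: gt0_ltr_powR => //; rewrite nnegrE.
  apply: covers_le (covers_self s (le_trans (cylinder_diam w1) _)) => //.
  exact/diam_pow_le/cylinder_diam.
move=> Ld.
(* A single term is at most the whole sum; this carries the hypothesis on [d] over to each child. *)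
have K_half i : P i -> K i `^ s <= 2^-1.
  move=> Pi; rewrite -lee_fin; apply: le_trans P_sum.
  rewrite (@nneseriesD1 _ _ i)//; last by move=> j _; rewrite lee_fin powR_ge0.
  by rewrite leeDl//; apply: nneseries_ge0 => j _ _; rewrite lee_fin powR_ge0.
have child i : P i -> L (rcons w i) `^ s * 2^-1 ^+ k =
    (L w `^ s * 2^-1 ^+ k) * K i `^ s.
  by move=> _; rewrite /L -cats1 big_cat big_seq1 /= powRM ?L_ge0// mulrAC.
(* Index 0 is excluded because it is not a digit, although [P] might contain it. *)
pose eta i := if P i && (0 < i)%N then ((L w `^ s * 2^-1 ^+ k)%:E * (K i `^ s)%:E)%E else 0%E.
apply: (@covers_le _ _ _ _
  (\bigcup_i (if P i && (0 < i)%N then cylinder (rcons w i) else set0))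
  (\sum_(0 <= i <oo) eta i)%E).
- move=> _ [u [u1 uw uP] <-]; exists (u (size w).+1) => //.
  rewrite uP// u1//; exists u => //; split=> //.
    by rewrite size_rcons prefix_wordS uw.
  by move=> n; rewrite size_rcons => /ltnW; exact: uP.
- apply: (@le_trans _ _ (\sum_(0 <= i <oo | P i) ((L w `^ s * 2^-1 ^+ k)%:E * (K i `^ s)%:E)%E)%E).
    rewrite [leRHS]eseries_mkcond; apply: lee_nneseries => i _ => [_|].
      rewrite /eta; case: ifP => // _.
      by rewrite -EFinM lee_fin !mulr_ge0 ?powR_ge0 ?exprn_ge0.
    rewrite /eta; case: (P i) => //=; case: ifP => // _.
    by rewrite -EFinM lee_fin !mulr_ge0 ?powR_ge0 ?exprn_ge0.
  rewrite nneseriesZl; last by move=> i _; rewrite lee_fin powR_ge0.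
  apply: (@le_trans _ _ ((L w `^ s * 2^-1 ^+ k)%:E * (2^-1)%:E)%E).
    by rewrite lee_wpmul2l// lee_fin mulr_ge0 ?powR_ge0 ?exprn_ge0.
  by rewrite -EFinM lee_fin exprSr mulrA.
- apply: covers_bigcup => i; rewrite /eta; case: ifPn => [/andP[Pi i0]|_]; last exact: covers_set0.
  rewrite -EFinM -child//; apply: IH => //.
    by rewrite /posw all_rcons i0.
  rewrite child//; apply: le_trans Ld; rewrite exprSr mulrA.
  by rewrite ler_wpM2l ?K_half// mulr_ge0 ?powR_ge0 ?exprn_ge0.
Qed.

(** There are countably many prefixes after which only digits of [P] occur, and the n-th cylinder is
    granted the share e / 2^(n+1). *)
Lemma eventually_digits_null d e : 0 < d -> 0 < e ->
  covers s d [set nat_proj f u | u in [set u | digit_seq u /\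
    exists N, forall n, (N < n)%N -> P (u n)]] e%:E.
Proof.
move=> d0 e0.
pose A n := if unpickle n is Some w then
  (if all (leq 1) w then cylinder w else set0) else set0.
pose eps n := (e / (2 ^ n.+1)%:R)%:E.
apply: (@covers_le _ _ _ _ (\bigcup_n A n) (\sum_(0 <= n <oo) eps n)%E).
- move=> _ [u [u1 [N uN]] <-].
  exists (pickle (prefix_word u N)) => //; rewrite /A pickleK.
  rewrite (posw_prefix_word N u1); exists u => //.
  by split; rewrite ?size_prefix_word.
- exact: (epsilon_trick0 xpredT (ltW e0)).
- apply: covers_bigcup => n; rewrite /A; case: unpickle => [w|]; last first.
    by apply: covers_le (covers_set0 s d) => //; rewrite lee_fin divr_ge0// ltW.
  case: ifP => [w1|_]; last first.
    by apply: covers_le (covers_set0 s d) => //; rewrite lee_fin divr_ge0// ltW.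
  have en0 : 0 < e / (2 ^ n.+1)%:R by rewrite divr_gt0// ltr0n expn_gt0.
  (* One [k] has to make both the diameters and the total size small. *)
  have m0 : 0 < Num.min (d `^ s) (e / (2 ^ n.+1)%:R) by rewrite lt_min powR_gt0.
  have [k Lk] : exists k, L w `^ s * 2^-1 ^+ k < Num.min (d `^ s) (e / (2 ^ n.+1)%:R).
    have : geometric (L w `^ s) 2^-1 k @[k --> \oo] --> (0 : R).
      by apply: cvg_geometric; rewrite ger0_norm ?invf_lt1 ?invr_ge0 ?ltr1n.
    move=> /cvgrPdist_lt/(_ _ m0) => -[k _ /(_ k (leqnn k))] /=.
    rewrite sub0r normrN ger0_norm; first by exists k.
    by rewrite mulr_ge0 ?powR_ge0 ?exprn_ge0 ?invr_ge0.
  move: Lk; rewrite lt_min => /andP[/ltW Ld /ltW Le].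
  apply: covers_le (cylinder_covers w1 (ltW d0) Ld) => //.
Qed.

End UpperBound.

(** * Lower bound *)

Section MassDistribution.
Context {R : realType}.
Variables (A : nat -> seq nat) (r : nat -> R) (s : R).
Implicit Types (v w : seq nat) (Q : pred (seq nat)).

Definition level_sum n := \sum_(i <- A n) r i `^ s.

(** The factor by which the probability of a word of length [n] differs from the [s]-th power of the
    product of its ratios. *)
Definition level_weight n := \prod_(1 <= k < n.+1) (level_sum k)^-1.

Definition admissible v :=
  forall j, (j < size v)%N -> nth 0%N v j \in A j.+1.

(* Conditional probability, given v, that the word of length [size v + k]
   obtained by drawing the next k digits i with probabilities proportional to
   r i `^ s satisfies Q. *)
Fixpoint mass Q k v : R :=
  if k is k'.+1 then
    \sum_(i <- A (size v).+1)
      r i `^ s / level_sum (size v).+1 * mass Q k' (rcons v i)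
  else (Q v)%:R.

Hypothesis level_sum_gt0 : forall n, (1 <= n)%N -> 0 < level_sum n.

Lemma admissible_nil : admissible [::]. Proof. by []. Qed.

Lemma admissible_rcons v i : admissible v -> i \in A (size v).+1 ->
  admissible (rcons v i).
Proof.
move=> av iA j; rewrite size_rcons ltnS nth_rcons leq_eqVlt.
by case: ltngtP => [jv _|_ //|-> _]; rewrite ?eqxx//; exact: av.
Qed.

Lemma admissible_catl v w : admissible (v ++ w) -> admissible v.
Proof.
move=> avw j jv; have := avw j; rewrite nth_cat jv; apply.
by rewrite size_cat ltn_addr.
Qed.

Lemma mass_predT k v : mass predT k v = 1.
Proof.
elim: k v => [|k IH] v //=.
under eq_bigr do rewrite IH mulr1.
by rewrite -mulr_suml divff// gt_eqF// level_sum_gt0.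
Qed.

Lemma mass_le1 Q k v : mass Q k v <= 1.
Proof.
rewrite -(mass_predT k v); elim: k v => [|k IH] v /=; first by rewrite ler_nat leq_b1.
by apply: ler_sum => i _; rewrite ler_wpM2l// divr_ge0 ?powR_ge0// ltW// level_sum_gt0.
Qed.

Lemma mass_neq0 Q k v : admissible v -> mass Q k v != 0 ->
  exists w, [/\ admissible (v ++ w), size w = k & Q (v ++ w)].
Proof.
elim: k v => [|k IH] v av /=.
  by rewrite pnatr_eq0 eqb0 negbK => Qv; exists [::]; rewrite cats0.
move=> m0; have /hasP[i iA mi] : has (fun i => mass Q k (rcons v i) != 0) (A (size v).+1).
  apply: contraNT m0 => /hasPn m0; rewrite big_seq big1// => i /m0.
  by rewrite negbK => /eqP ->; rewrite mulr0.
have [w [aw wk Qw]] := IH _ (admissible_rcons av iA) mi.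
by exists (i :: w); rewrite -cat_rcons /= wk.
Qed.

(** Union bound: the events exhaust all words of length [k], whose total mass is 1 by
    [mass_predT]. *)
Lemma mass_cover (m : nat) (Q : nat -> pred (seq nat)) k v : admissible v ->
  (forall w, admissible (v ++ w) -> size w = k -> exists2 i, (i < m)%N & Q i (v ++ w)) ->
  1 <= \sum_(i < m) mass (Q i) k v.
Proof.
elim: k v => [|k IH] v av Qv /=.
  have [] := Qv [::]; rewrite ?cats0// => i im Qi.
  by rewrite (bigD1 (Ordinal im))//= Qi lerDl sumr_ge0.
rewrite exchange_big/= -[leLHS](mass_predT k.+1 v) /= big_seq [leRHS]big_seq.
apply: ler_sum => i iA; rewrite mass_predT -mulr_sumr.
rewrite ler_wpM2l ?divr_ge0 ?powR_ge0 ?(ltW (level_sum_gt0 _))//.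
apply: IH; first exact: admissible_rcons.
by move=> w; rewrite cat_rcons => aw wk; apply: Qv => //=; rewrite wk.
Qed.

End MassDistribution.

(** * Lebesgue measure of disjoint pieces and of intervals near a ball *)

Section MeasureSum.
Context {R : realType}.
Local Notation mu := (@lebesgue_measure R).

Lemma sum_measure_le (t : seq nat) (F : nat -> set R) (B : set R) :
  uniq t -> measurable B -> (forall i, i \in t -> measurable (F i)) ->
  (forall i, i \in t -> F i `<=` B) ->
  (forall i j, i \in t -> j \in t -> i <> j -> F i `&` F j = set0) ->
  (\sum_(i <- t) mu (F i) <= mu B)%E.
Proof.
elim: t B => [|a t IH] B; first by rewrite big_nil.
move=> /= /andP[at_ ut] mB mF FB FF; rewrite big_cons.
have mFa : measurable (F a) by apply: mF; rewrite mem_head.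
rewrite (measureDI mu mB mFa) addeC (setIidr (FB a (mem_head _ _))) leeD2r//.
apply: IH => //.
- exact: measurableD.
- by move=> i it; apply: mF; rewrite in_cons it orbT.
- move=> i it x Fix; split; first by apply: (FB i) => //; rewrite in_cons it orbT.
  move=> Fax; have : (F i `&` F a) x by [].
  rewrite FF ?mem_head//; first by rewrite in_cons it orbT.
  by move=> ia; rewrite -ia it in at_.
- by move=> i j it jt; apply: FF; rewrite in_cons ?it ?jt orbT.
Qed.

(** A closed interval that meets the ball of radius [d] has, inside the concentric ball of radius 3
    d, either its whole length or a piece of length at least 2 d. *)
Lemma measure_itv_ball (m M p c d l : R) : m <= p <= M -> `|p - c| < d ->
  l <= 2 * d -> l <= M - m -> 0 <= l ->
  (l%:E <= mu (`]m, M[ `&` `](c - 3 * d)%R, (c + 3 * d)%R[))%E.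
Proof.
move=> /andP[mp pM] /[!ltr_distl] /andP[pc cp] ld lM l0.
pose a := Num.max m (c - 3 * d); pose b := Num.min M (c + 3 * d).
have lab : l <= b - a.
  rewrite /a /b maxEle minEle; do 2 case: ifP => _; lra.
apply: (@le_trans _ _ (mu `]a, b[)).
  rewrite lebesgue_measure_itv/= lte_fin; case: ltP => ab.
    by rewrite -EFinD lee_fin.
  by rewrite lee_fin; lra.
apply: le_measure; rewrite ?inE//; first exact: measurableI.
move=> x; rewrite /= !in_itv/= /a /b gt_max lt_min => /andP[/andP[-> ->] /andP[-> ->]].
by [].
Qed.

End MeasureSum.

(** * The mass of a ball and the mass distribution principle *)

Section MassDistributionPrinciple.
Context {R : realType}.
Variables (f : nat -> R -> R) (A : nat -> seq nat) (r : nat -> R) (s C : R).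
Hypothesis f_iIFS : iIFS f.
Hypothesis f_crit : forall n (x : R), (1 <= n)%N -> 0 < x < 1 -> deriv01 (f n) x != 0.
Hypothesis f_exp : forall n (x y : R), (1 <= n)%N -> 0 <= x <= 1 -> 0 <= y <= 1 ->
  r n * `|x - y| <= `|f n x - f n y|.
Hypothesis C_ge0 : 0 <= C.
Hypothesis r_ge0 : forall n, 0 <= r n.
Hypothesis s_gt0 : 0 < s.
Hypothesis A_uniq : forall n, (1 <= n)%N -> uniq (A n).
Hypothesis A_gt0 : forall n i, (1 <= n)%N -> i \in A n -> (1 <= i)%N.
Hypothesis level_sum_gt0 : forall n, (1 <= n)%N -> 0 < level_sum A r s n.
Hypothesis weight_le : forall n i, (1 <= n)%N -> i \in A n ->
  level_weight A r s n <= C * r i.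
Implicit Types (v w : seq nat) (c d : R).

Local Notation mu := (@lebesgue_measure R).
Local Notation G := (level_weight A r s).
Local Notation adm := (admissible A).
Let l v := \prod_(i <- v) r i.

Lemma admissible_posw v : adm v -> posw v.
Proof.
by move=> av; apply/(all_nthP 0%N) => j jv; apply: (A_gt0 _ (av j jv)).
Qed.

Let l_ge0 v : 0 <= l v. Proof. exact: prodr_ge0. Qed.

Let l_rcons v i : l (rcons v i) = l v * r i.
Proof. by rewrite /l -cats1 big_cat big_seq1. Qed.

Let G_ge0 n : 0 <= G n.
Proof.
rewrite /level_weight big_nat_cond prodr_ge0// => k /andP[/andP[k1 _] _].
by rewrite invr_ge0 ltW// level_sum_gt0.
Qed.

Let G_S n : G n.+1 = G n * (level_sum A r s n.+1)^-1.
Proof. by rewrite /level_weight big_nat_recr. Qed.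

Let J v := compw f v @` `]0, 1[.

Let J_itv v : posw v -> J v =
  `]Num.min (compw f v 0) (compw f v 1), Num.max (compw f v 0) (compw f v 1)[%classic.
Proof. exact: compw_image_oo. Qed.

Let l_le_width v : adm v ->
  l v <= Num.max (compw f v 0) (compw f v 1) - Num.min (compw f v 0) (compw f v 1).
Proof.
move=> av.
have := compw_expansion (ifs_in01 f_iIFS) f_exp r_ge0 (admissible_posw av)
   (x := 0) (y := 1).
rewrite !lexx ler01 sub0r normrN normr1 mulr1 => /(_ isT isT).
by move/le_trans; apply; rewrite maxEle minEle; case: ifP => h; rewrite ler_norml; lra.
Qed.

(** Containment of the whole image, rather than of a limit point, is a condition on a finite word
    and is inherited by its extensions. *)
Definition within_ball c d : pred (seq nat) := fun w =>
  `[< forall x, 0 <= x <= 1 -> `|compw f w x - c| < d >].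

Section Ball.
Variables c d : R.
Hypothesis d_gt0 : 0 < d.

(** The tripled ball leaves room for each stopped word to own a length [l v] inside it; [lam]
    measures this length and is superadditive over children. *)
Let V := (`]c - 3 * d, c + 3 * d[%classic : set R).
Let lam v := fine (mu (J v `&` V)).

Let mV : measurable V. Proof. exact: measurable_itv. Qed.

Let mJ v : posw v -> measurable (J v).
Proof. by move=> v1; rewrite J_itv//; exact: measurable_itv. Qed.

Let mu_V : mu V = (6 * d)%:E.
Proof.
rewrite lebesgue_measure_itv/= lte_fin ifT; last by move: d_gt0; lra.
by rewrite -EFinD; congr EFin; lra.
Qed.

Let lamE v : posw v -> mu (J v `&` V) = (lam v)%:E.
Proof.
move=> v1; rewrite /lam fineK// ge0_fin_numE//.
apply: (@le_lt_trans _ _ (mu V)); last by rewrite mu_V ltry.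
by apply: le_measure; rewrite ?inE//; apply: measurableI => //; exact: mJ.
Qed.

Let lam_ge0 v : 0 <= lam v. Proof. by rewrite /lam fine_ge0. Qed.

Let lam_children v : adm v ->
  \sum_(i <- A (size v).+1) lam (rcons v i) <= lam v.
Proof.
move=> av; have v1 := admissible_posw av.
have posw_child i : i \in A (size v).+1 -> posw (rcons v i).
  by move=> iA; exact/admissible_posw/admissible_rcons.
rewrite -lee_fin -lamE// -sumEFin big_seq.
under eq_bigr => i iA do rewrite -(lamE (posw_child i iA)).
rewrite -big_seq; apply: sum_measure_le.
- exact: A_uniq.
- by apply: measurableI => //; exact: mJ.
- by move=> i iA; apply: measurableI => //; apply: mJ; exact: posw_child.
- move=> i iA; apply: setSI; apply: compw_image_rcons => //.
  exact: A_gt0 (ltn0Sn _) iA.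
- move=> i j iA jA ij; rewrite setIACA compw_image_disjoint ?set0I//.
    exact: A_gt0 (ltn0Sn _) iA.
  exact: A_gt0 (ltn0Sn _) jA.
Qed.

Let l_le_lam v w : adm v -> posw w -> l v <= 2 * d -> within_ball c d (v ++ w) ->
  l v <= lam v.
Proof.
move=> av w1 lv /asboolP Qvw; have v1 := admissible_posw av.
rewrite -lee_fin -lamE// J_itv//.
have o01 : 0 <= (1 : R) <= 1 by rewrite ler01 lexx.
have := Qvw 1 o01; rewrite compw_cat.
have := compw01 (ifs_in01 f_iIFS) w1 o01.
move: (compw f w 1) => z z01 pd.
apply: measure_itv_ball pd lv (l_le_width av) (l_ge0 v).
have [z_oo|] := boolP (0 < z < 1).
  have : J v (compw f v z) by exists z; rewrite //= in_itv.
  by rewrite J_itv//= in_itv/= => /andP[? ?]; rewrite !ltW.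
case/andP: z01; rewrite le_eqVlt => /predU1P[<- _ _|z0].
  by rewrite ge_min le_max !lexx.
rewrite le_eqVlt => /predU1P[->|z1]; first by rewrite ge_min le_max !lexx !orbT.
by rewrite z0 z1.
Qed.

(** Induction down the tree, stopping once [l] drops to 2 d. At a stopped child, [weight_le]
    supplies a factor [r i], which is at most [l (rcons v i) / (2 * d)] since the parent is longer
    than 2 d, and [l_le_lam] turns this into length. Lengths of children then add up to at most that
    of the parent. *)
Lemma mass_ball_le k v : adm v -> 2 * d < l v ->
  G (size v) * l v `^ s * mass A r s (within_ball c d) k v <=
  C * (2 * d) `^ s / (2 * d) * lam v.
Proof.
have d2_gt0 : 0 < 2 * d by rewrite mulr_gt0.
have B_ge0 : 0 <= C * (2 * d) `^ s / (2 * d).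
  by rewrite divr_ge0 ?mulr_ge0 ?powR_ge0// ltW.
elim: k v => [|k IH] v av dv /=.
  (* An image of length greater than 2 d does not fit into the ball. *)
  suff /negbTE -> : ~~ within_ball c d v by rewrite mulr0 mulr_ge0.
  apply/negP => /asboolP Qv.
  have := Qv 0; rewrite lexx ler01 => /(_ isT) Q0.
  have := Qv 1; rewrite lexx ler01 => /(_ isT) Q1.
  have := l_le_width av; move: Q0 Q1; rewrite !ltr_distl maxEle minEle.
  by move=> /andP[? ?] /andP[? ?]; case: ifP => _; lra.
apply: (@le_trans _ _ (C * (2 * d) `^ s / (2 * d) *
    \sum_(i <- A (size v).+1) lam (rcons v i))); last first.
  by rewrite ler_wpM2l// lam_children.
rewrite !mulr_sumr big_seq [leRHS]big_seq; apply: ler_sum => i iA.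
have avi := admissible_rcons av iA.
have -> : G (size v) * l v `^ s * (r i `^ s / level_sum A r s (size v).+1 *
    mass A r s (within_ball c d) k (rcons v i)) =
  G (size (rcons v i)) * l (rcons v i) `^ s *
    mass A r s (within_ball c d) k (rcons v i).
  by rewrite size_rcons G_S l_rcons powRM//; ring.
have [dvi|vid] := ltP (2 * d) (l (rcons v i)); first exact: IH.
have [->|m0] := eqVneq (mass A r s (within_ball c d) k (rcons v i)) 0.
  by rewrite mulr0 mulr_ge0.
(* Nonzero mass gives an extension inside the ball, so the image of the stopped word comes close to
   [c]. *)
have [w [avw _ Qvw]] := mass_neq0 avi m0.
have w1 : posw w by move: (admissible_posw avw); rewrite /posw all_cat => /andP[].
have lvi := l_le_lam avi w1 vid Qvw.
apply: (@le_trans _ _ (C * (2 * d) `^ s / (2 * d) * l (rcons v i))); last first.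
  by rewrite ler_wpM2l.
apply: (@le_trans _ _ (G (size (rcons v i)) * l (rcons v i) `^ s)).
  by rewrite ler_piMr ?mulr_ge0 ?powR_ge0//; exact: mass_le1.
apply: (@le_trans _ _ (C * r i * (2 * d) `^ s)).
  rewrite ler_pM ?powR_ge0//; first by rewrite size_rcons; exact: weight_le.
  by apply: ge0_ler_powR => //; rewrite ?nnegrE// ltW.
have ri : r i <= l (rcons v i) / (2 * d).
  by rewrite ler_pdivlMr// l_rcons mulrC ler_wpM2r// ltW.
have -> : C * r i * (2 * d) `^ s = C * (2 * d) `^ s * r i by ring.
have -> : C * (2 * d) `^ s / (2 * d) * l (rcons v i) =
  C * (2 * d) `^ s * (l (rcons v i) / (2 * d)) by ring.
by rewrite ler_wpM2l// mulr_ge0 ?powR_ge0.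
Qed.

(** For 2 d < 1 the empty word is not stopped and [lam [::] <= 6 * d] yields the term 3 C; for
    larger [d] the total mass 1 is already below (2 d)^s, whence the extra 1. *)
Lemma mass_ball_le_powR k :
  mass A r s (within_ball c d) k [::] <= (3 * C + 1) * (2 * d) `^ s.
Proof.
have d2_gt0 : 0 < 2 * d by rewrite mulr_gt0.
have [d1|d1] := ltP (2 * d) 1; last first.
  apply: (@le_trans _ _ 1); first exact: mass_le1.
  apply: (@le_trans _ _ (1 * (2 * d) `^ s)).
    have : 1 `^ s <= (2 * d) `^ s by apply: ge0_ler_powR; rewrite ?nnegrE// ltW.
    by rewrite powR1 mul1r.
  by rewrite ler_wpM2r ?powR_ge0// lerDr mulr_ge0.
have := @mass_ball_le k [::] (@admissible_nil A).
rewrite /level_weight big_geq// /l big_nil powR1 !mul1r => /(_ d1)/le_trans; apply.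
have lamV : lam [::] <= 6 * d.
  rewrite -lee_fin -lamE// -mu_V; apply: le_measure; rewrite ?inE//.
  by apply: measurableI => //; exact: mJ.
apply: le_trans (ler_wpM2l _ lamV) _.
  by rewrite divr_ge0 ?mulr_ge0 ?powR_ge0// ltW.
have -> : C * (2 * d) `^ s / (2 * d) * (6 * d) = 3 * C * (2 * d) `^ s.
  by field; rewrite gt_eqF.
by rewrite ler_wpM2r ?powR_ge0// lerDl.
Qed.

End Ball.

(* Koenig's lemma: the tree of admissible words is finitely branching. *)
Lemma finite_subcover (c d : nat -> R) :
  [set nat_proj f u | u in [set u | forall n, (1 <= n)%N -> u n \in A n]] `<=`
    \bigcup_i ball (c i) (d i) ->
  exists m N, forall w, adm w -> size w = N ->
    exists2 i, (i < m)%N & within_ball (c i) (d i) w.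
Proof.
move=> Tcd.
(* Finitely many balls and a uniform depth suffice below [v]. *)
pose good v := exists m N, forall w, adm (v ++ w) -> size w = N ->
  exists2 i, (i < m)%N & within_ball (c i) (d i) (v ++ w).
apply: (contrapT (P := good [::])) => bad0.
have good_children v : (forall i, i \in A (size v).+1 -> good (rcons v i)) -> good v.
  move=> gv.
  have [m [N mN]] : exists m N, forall i, i \in A (size v).+1 ->
      forall w, adm (rcons v i ++ w) -> (N <= size w)%N ->
      exists2 j, (j < m)%N & within_ball (c j) (d j) (rcons v i ++ w).
    elim: (A (size v).+1) gv => [|a t IH] gv; first by exists 0%N, 0%N.
    have [|m1 [N1 H1]] := IH; first by move=> i it; apply: gv; rewrite in_cons it orbT.
    have [m2 [N2 H2]] := gv a (mem_head _ _).
    exists (maxn m1 m2), (maxn N1 N2) => i; rewrite in_cons => /predU1P[->|it] w aw;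
        rewrite geq_max => /andP[N1w N2w]; last first.
      have [j jm Qj] := H1 i it w aw N1w.
      by exists j => //; rewrite leq_max jm.
    (* Words deeper than [N2] are truncated; membership in the ball persists from the truncation to
       the word. *)
    have [||j jm Qj] := H2 (take N2 w).
    - by move: aw; rewrite -{1}(cat_take_drop N2 w) catA => /admissible_catl.
    - exact: size_takel.
    - exists j; first by rewrite leq_max jm orbT.
      have dw1 : posw (drop N2 w).
        have := admissible_posw aw; rewrite /posw -{1}(cat_take_drop N2 w) catA all_cat.
        by case/andP.
      apply/asboolP => x x01; rewrite -(cat_take_drop N2 w) catA compw_cat.
      by move/asboolP: Qj; apply; exact: (compw01 (ifs_in01 f_iIFS)).
  exists m, N.+1 => -[//|i w] aw [wN].
  have iA : i \in A (size v).+1.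
    have := aw (size v); rewrite size_cat/= nth_cat ltnn subnn/=; apply.
    by rewrite addnS ltnS leq_addr.
  rewrite -cat_rcons; apply: mN => //; last by rewrite wN.
  by rewrite cat_rcons.
have /choice[g gP] v : exists i, ~ good v -> i \in A (size v).+1 /\ ~ good (rcons v i).
  have [gv|bv] := pselect (good v); first by exists 0%N.
  have /existsNP[i /not_implyP[iA bvi]] :
      ~ forall i, i \in A (size v).+1 -> good (rcons v i).
    by move=> H; apply: bv; exact: good_children.
  by exists i.
(* The infinite path of bad words; [n.-1] appears because digits are numbered from 1. *)
pose W n := iter n (fun v => rcons v (g v)) [::].
pose u n := g (W n.-1).
have uW n : prefix_word u n = W n.
  by elim: n => // n IH; rewrite prefix_wordS IH.
have Wbad n : ~ good (W n).
  by elim: n => // n IH; have [] := gP _ IH.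
have uA n : (1 <= n)%N -> u n \in A n.
  case: n => // n _; have [] := gP _ (Wbad n).
  by rewrite -uW size_prefix_word uW.
have u1 : digit_seq u by move=> n n1; apply: A_gt0 (uA n n1).
have [i _] := Tcd (nat_proj f u) (ex_intro2 _ _ u uA erefl).
rewrite /ball/= => xcd.
have [q [rho [q0 /andP[rho0 rho1] ctr]]] := compw_contraction f_iIFS f_crit.
have e0 : 0 < d i - `|c i - nat_proj f u| by rewrite subr_gt0.
have [k ke] : exists k, rho ^+ k < d i - `|c i - nat_proj f u|.
  have : rho ^+ k @[k --> \oo] --> 0 by apply: cvg_expr; rewrite ger0_norm// ltW.
  move=> /cvgrPdist_lt/(_ _ e0) => -[k _ /(_ k (leqnn k))] /=.
  by rewrite sub0r normrN ger0_norm ?exprn_ge0 ?(ltW rho0)//; exists k.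
(* The image of this prefix contains the projected point and is smaller than the point's margin in
   the open ball [i], so that ball alone makes the prefix good. *)
apply: (Wbad (k * q)%N); exists i.+1, 0%N => w _ /size0nil ->.
exists i => //; rewrite cats0; apply/asboolP => x x01.
have [y y01 Ey] := nat_proj_prefix f_iIFS f_crit (k * q) u1.
rewrite -uW -(subrK (nat_proj f u) (compw _ _ x)) -addrA.
apply: le_lt_trans (ler_normD _ _) _; rewrite (distrC _ (c i)) -ltrBrDr.
apply: le_lt_trans ke; rewrite Ey.
apply: le_trans (ctr _ _ _ (posw_prefix_word _ u1) x01 y01) _.
by rewrite size_prefix_word mulnK.
Qed.

(** A cheap cover is enlarged to open balls, reduced to a finite one by [finite_subcover], and
    refuted by the union bound: the masses would sum to less than 1. *)
Lemma not_null_of_weights :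
  ~ forall e, 0 < e -> covers s 1
      [set nat_proj f u | u in [set u | forall n, (1 <= n)%N -> u n \in A n]] e%:E.
Proof.
move=> null.
pose B := (3 * C + 1) * 2 `^ s.
have B_gt0 : 0 < B by rewrite mulr_gt0 ?powR_gt0// ltr_wpDl// mulr_ge0.
(* Chosen so that the final bound B (e + e) equals 1/2. *)
pose e := (4 * B)^-1.
have e_gt0 : 0 < e by rewrite invr_gt0 mulr_gt0.
have [U [TU dU] Ue] := null e e_gt0.
pose D i := fine (diam_pow s (U i)).
have DE i : diam_pow s (U i) = (D i)%:E.
  rewrite /D fineK// ge0_fin_numE ?diam_pow_ge0//.
  by apply: le_lt_trans (diam_pow_le s_gt0 (dU i)) _; rewrite ltry.
have D_ge0 i : 0 <= D i by rewrite -lee_fin -DE diam_pow_ge0.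
(* The summable extra term makes every radius positive and lets open balls contain the [U i]. *)
pose h i := D i + e / (2 ^ i.+1)%:R.
have h_gt0 i : 0 < h i.
  by rewrite ltr_wpDl// divr_gt0// ltr0n expn_gt0.
pose d i := h i `^ s^-1.
have d_gt0 i : 0 < d i by rewrite powR_gt0.
have dS i : d i `^ s = h i by rewrite /d -powRrM mulVf ?gt_eqF// powRr1// ltW.
have /choice[c cP] i : exists c, U i `<=` ball c (d i).
  have [->|/set0P[c Uc]] := eqVneq (U i) set0; first by exists 0.
  exists c => x Ux; rewrite /ball/=.
  have U0 : U i != set0 by apply/set0P; exists c.
  have cx : (`|c - x|%:E <= diam (U i))%E by apply: ereal_sup_ubound; exists (c, x).
  rewrite ltNge; apply/negP => dcx.
  have : ((d i `^ s)%:E <= diam_pow s (U i))%E.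
    rewrite /diam_pow (negbTE U0) -poweR_EFin; apply: gt0_ler_poweR.
    - exact: ltW.
    - by rewrite in_itv/= lee_fin (ltW (d_gt0 i)) leey.
    - by rewrite in_itv/= leey diam_ge0//; exists c.
    - by apply: le_trans cx; rewrite lee_fin.
  rewrite DE dS lee_fin /h gerDl leNgt => /negP; apply.
  by rewrite divr_gt0// ltr0n expn_gt0.
have [x /TU[i _ Uix]|m [N mN]] := @finite_subcover c d.
  by exists i => //; exact: cP.
have := mass_cover level_sum_gt0 (Q := fun i => within_ball (c i) (d i)) (@admissible_nil A) mN.
apply/negP; rewrite -ltNge.
apply: (@le_lt_trans _ _ (\sum_(i < m) B * h i)).
  apply: ler_sum => i _; apply: le_trans (mass_ball_le_powR _ _ _) _ => //.
  by rewrite powRM ?(ltW (d_gt0 i))// dS mulrA.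
rewrite -mulr_sumr big_split/=.
have De : \sum_(i < m) D i <= e.
  rewrite -lee_fin -sumEFin; apply: le_trans Ue.
  under eq_bigr do rewrite -DE.
  rewrite -(big_mkord xpredT (fun i => diam_pow s (U i))).
  by apply: nneseries_lim_ge => i _ _; exact: diam_pow_ge0.
have ee : \sum_(i < m) e / (2 ^ i.+1)%:R <= e.
  rewrite -lee_fin -sumEFin; apply: le_trans (epsilon_trick0 xpredT (ltW e_gt0)).
  rewrite -(big_mkord xpredT (fun i => (e / (2 ^ i.+1)%:R)%:E)).
  by apply: nneseries_lim_ge => i _ _; rewrite lee_fin divr_ge0// ltW.
apply: (@le_lt_trans _ _ (B * (e + e))); first by rewrite ler_wpM2l ?(ltW B_gt0)// lerD.
have -> : B * (e + e) = 2^-1 by rewrite /e; field; rewrite gt_eqF.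
by lra.
Qed.

End MassDistributionPrinciple.

(** * Selection of digit blocks *)

Section DigitChoice.
Context {R : realType}.

(** Diagonal choice: [J n] is the largest [j <= n] whose property holds from [n] on, with 0 as the
    value when there is none. *)
Lemma slow_index (Q : nat -> nat -> Prop) :
  (forall j, \forall n \near \oo, Q j n) ->
  exists J : nat -> nat, J n @[n --> \oo] --> \oo /\
    forall n, (0 < J n)%N -> Q (J n) n.
Proof.
move=> nQ; pose p n j := `[< forall k, (n <= k)%N -> Q j k >].
exists (fun n => \max_(j < n.+1 | p n j) j); split=> [|n].
  apply/cvgnyPge => j; have [N _ QN] := nQ j.
  exists (maxn N j) => // n /=; rewrite geq_max => /andP[Nn jn].
  have pj : p n j by apply/asboolP => k nk; apply: QN; exact: leq_trans nk.
  rewrite -ltnS in jn.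
  exact: (@leq_bigmax_cond _ (fun i : 'I_n.+1 => p n i) (fun i => nat_of_ord i) (Ordinal jn)).
suff [-> //|/asboolP H _] : \max_(j < n.+1 | p n j) j = 0%N \/
    p n (\max_(j < n.+1 | p n j) j) by exact: H.
apply: (big_ind (fun m => m = 0%N \/ p n m)); first by left.
  by move=> x y [->|px] [->|py]; rewrite ?max0n ?maxn0; [left|right|right|];
    rewrite // /maxn; case: ifP; right.
by move=> j pj; right.
Qed.

Lemma near_all_seq (t : seq nat) (Q : nat -> nat -> Prop) :
  (forall i, i \in t -> \forall n \near \oo, Q i n) ->
  \forall n \near \oo, forall i, i \in t -> Q i n.
Proof.
elim: t => [|a t IH] nQ; first by near=> n.
have nt : \forall n \near \oo, forall i, i \in t -> Q i n.
  by apply: IH => i it; apply: nQ; rewrite in_cons it orbT.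
apply: filterS2 (nQ a (mem_head _ _)) nt => n Qa Qt i.
by rewrite in_cons => /predU1P[->//|]; exact: Qt.
Unshelve. all: by end_near. Qed.

(** If every block beyond [j] had sum below [M], the series would be at most its first [j] terms
    plus [M]. *)
Lemma divergent_block (h : nat -> R) (D : set nat) (M : R) j :
  (forall n, 0 <= h n) -> (\esum_(n in D) (h n)%:E = +oo)%E ->
  exists t, [/\ uniq t, forall i, i \in t -> D i /\ (j <= i)%N &
    M <= \sum_(i <- t) h i].
Proof.
move=> h0 hD; apply: contrapT => noblock.
have block m : \sum_(j <= i < j + m | `[< D i >]) h i < M.
  rewrite ltNge; apply/negP => Mle; apply: noblock.
  exists [seq i <- index_iota j (j + m) | `[< D i >]]; split.
  - by rewrite filter_uniq// iota_uniq.
  - by move=> i; rewrite mem_filter mem_index_iota => /and3P[/asboolP].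
  - by rewrite big_filter.
have := nneseries_esum (P := fun i => `[< D i >]) (a := fun n => (h n)%:E).
rewrite (_ : [set x | _] = D); last by apply/seteqP; split=> i /asboolP.
rewrite hD => /(_ _)/esym sumD.
suff : (\sum_(0 <= i <oo | `[< D i >]) (h i)%:E <=
    (\sum_(0 <= i < j | `[< D i >]) h i + M)%:E)%E.
  by rewrite -sumD// => n _; rewrite lee_fin.
apply: lime_le.
  by apply: is_cvg_nneseries_cond => n _ _; rewrite lee_fin.
apply: nearW => n; rewrite sumEFin lee_fin.
apply: (@le_trans _ _ (\sum_(0 <= i < j + n | `[< D i >]) h i)).
  rewrite [leRHS](@big_cat_nat _ _ _ n)//= ?leq_addl// lerDl.
  by rewrite sumr_ge0.
by rewrite (@big_cat_nat _ _ _ j)//= ?leq_addr// lerD2l ltW.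
Qed.

Lemma eventually_nonincreasing_bounded (g : nat -> R) N :
  (forall n, 0 <= g n) -> (forall n, (N <= n)%N -> g n.+1 <= g n) ->
  exists2 M, 0 <= M & forall n, g n <= M.
Proof.
move=> g0 gN; exists (\sum_(k < N.+1) g k); first exact: sumr_ge0.
elim=> [|n IH]; first by rewrite (bigD1 ord0)//= lerDl sumr_ge0.
have [Nn|nN] := leqP N n; first exact: le_trans (gN n Nn) IH.
by rewrite -ltnS in nN; rewrite (bigD1 (Ordinal nN))//= lerDl sumr_ge0.
Qed.

Lemma minN_in (D : set nat) : D !=set0 -> D (minN D).
Proof.
move=> [n0 Dn0].
have exD : exists n, `[< D n >] by exists n0; exact/asboolP.
have [m /asboolP Dm minm] := ex_minnP exD.
have : (D `&` lbound D) (minN D).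
  apply: (xgetPex 0%N); exists m; split=> // n Dn.
  by apply: minm; exact/asboolP.
by case.
Qed.

End DigitChoice.

(** * Metric consequences of regularity *)

Section Regularity.
Context {R : realType}.
Variables (f : nat -> R -> R) (xi : nat -> R).
Hypothesis f_iIFS : iIFS f.
Hypothesis xi_gt0 : forall n, (1 <= n)%N -> 0 < xi n.
Hypothesis f_regular : xi_regular xi f.

Lemma regular_crit n (x : R) : (1 <= n)%N -> 0 < x < 1 -> deriv01 (f n) x != 0.
Proof.
move=> n1 /andP[x0 x1].
have xI : x \in `[0, 1] by rewrite in_itv/= !ltW.
have [c1 [c2 [c10 _ /(_ n x n1 xI)/andP[+ _]]]] := f_regular ltr01.
rewrite -normr_gt0; apply: lt_le_trans.
by rewrite divr_gt0// powR_gt0// xi_gt0.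
Qed.

Lemma regular_lipschitz eps : 0 < eps -> exists2 c, 0 < c &
  forall n (x y : R), (1 <= n)%N -> 0 <= x <= 1 -> 0 <= y <= 1 ->
  `|f n x - f n y| <= c / xi n `^ (1 - eps) * `|x - y|.
Proof.
move=> eps0; have [c1 [c2 [c10 c20 reg]]] := f_regular eps0.
exists c2 => // n x y n1; apply: (@dist_le_deriv01 _ _ (deriv01 (f n))).
- exact: ifs_continuous.
- by move=> z; exact: ifs_is_derive.
- move=> z /andP[z0 z1]; have zI : z \in `[0, 1] by rewrite in_itv/= !ltW.
  by have /andP[] := reg n z n1 zI.
Qed.

Lemma regular_expansion eps : 0 < eps -> exists2 c, 0 < c &
  forall n (x y : R), (1 <= n)%N -> 0 <= x <= 1 -> 0 <= y <= 1 ->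
  c / xi n `^ (1 + eps) * `|x - y| <= `|f n x - f n y|.
Proof.
move=> eps0; have [c1 [c2 [c10 c20 reg]]] := f_regular eps0.
exists c1 => // n x y n1; apply: (@dist_ge_deriv01 _ _ (deriv01 (f n))).
- exact: ifs_continuous.
- by move=> z; exact: ifs_is_derive.
- move=> z /andP[z0 z1]; have zI : z \in `[0, 1] by rewrite in_itv/= !ltW.
  by have /andP[] := reg n z n1 zI.
Qed.

End Regularity.

(** * The dimension *)

Section Dimension.
Context {R : realType}.
Variables (f : nat -> R -> R) (xi : nat -> R) (a : R -> nat -> nat) (D : set nat)
  (phi : nat -> R).
Hypothesis f_iIFS : iIFS f.
Hypothesis xi_gt0 : forall n, (1 <= n)%N -> 0 < xi n.
Hypothesis f_regular : xi_regular xi f.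
Hypothesis a_digits : digits_of f a.
Hypothesis D_pos : forall n, D n -> (1 <= n)%N.

Let f_crit := regular_crit xi_gt0 f_regular.

Lemma E_set_null (s t d e : R) : 0 <= t -> t < s ->
  (\esum_(n in D) (1 / xi n `^ t)%:E < +oo)%E -> 0 < d -> 0 < e ->
  covers s d (E_set f a D) e%:E.
Proof.
move=> t0 ts sumt d0 e0.
have s0 : 0 < s by exact: le_lt_trans ts.
(* With this epsilon, (1 - epsilon) s = t, so that [K n] to the power [s] is a constant times
   xi_n^-t. *)
have eps0 : 0 < 1 - t / s by rewrite subr_gt0 ltr_pdivrMr// mul1r.
have [c c0 f_lip] := regular_lipschitz f_iIFS f_regular eps0.
pose K n := c / xi n `^ (1 - (1 - t / s)).
have K0 n : 0 <= K n by rewrite /K divr_ge0 ?powR_ge0// ltW.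
have Ks n : K n `^ s = c `^ s * (1 / xi n `^ t).
  rewrite /K powRM ?invr_ge0 ?powR_ge0 ?(ltW c0)// -powRN -powRrM.
  by rewrite mul1r -powRN; congr (_ * _ `^ _); field; rewrite gt_eqF.
pose h n := (K n `^ s)%:E.
have h0 n : (0 <= h n)%E by rewrite lee_fin powR_ge0.
have sumK : (\sum_(0 <= n <oo | `[< D n >]) h n < +oo)%E.
  under eq_eseriesr do rewrite /h Ks EFinM.
  rewrite nneseriesZl; last by move=> n _; rewrite lee_fin divr_ge0// powR_ge0.
  rewrite lte_mul_pinfty// ?lee_fin ?powR_ge0//.
  rewrite nneseries_esum; last by move=> n _; rewrite lee_fin divr_ge0// powR_ge0.
  by rewrite (_ : [set x | _] = D)//; apply/seteqP; split=> i /asboolP.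
have [N sumN] : exists N, (\sum_(N <= n <oo | `[< D n >]) h n <= (2^-1)%:E)%E.
  have /fine_cvgP[finN cvgN] := nneseries_tail_cvg sumK (fun n _ => h0 n).
  have half0 : 0 < 2^-1 :> R by rewrite invr_gt0.
  move/cvgrPdist_lt : cvgN => /(_ _ half0) cvgN.
  have [N [fN bN]] := filter_ex (filterI finN cvgN); exists N.
  rewrite -(fineK fN) lee_fin; move: bN; rewrite /= sub0r normrN => /ltW.
  exact/le_trans/ler_norm.
pose P n := `[< D n >] && (N <= n)%N.
have sumP : (\sum_(0 <= n <oo | P n) (K n `^ s)%:E <= (2^-1)%:E)%E.
  by rewrite -eseries_cond.
apply: covers_le (eventually_digits_null f_iIFS f_crit f_lip K0 s0 sumP d0 e0) => //.
move=> x [xA xD xoo]; have [a1 ax] := a_digits xA.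
exists (a x) => //; split=> //.
have [M _ aM] : \forall n \near \oo, (N <= a x n)%N by move/cvgnyPge : xoo; exact.
(* The maximum with 1 skips the meaningless digit of index 0. *)
exists (maxn M 1) => n; rewrite gtn_max => /andP[Mn n1]; apply/andP; split.
  by apply/asboolP/xD/ltnW.
by apply: aM; exact: ltnW.
Qed.

Hypothesis D_infinite : infinite_set D.
Hypothesis phi_ge : forall n, (1 <= n)%N -> (minN D)%:R <= phi n.
Hypothesis phi_cvg : phi n @[n --> \oo] --> +oo.

Lemma S_set_not_null (s t : R) : 0 < s -> s < t ->
  (\esum_(n in D) (1 / xi n `^ t)%:E = +oo)%E ->
  ~ forall e, 0 < e -> covers s 1 (S_set f a D phi) e%:E.
Proof.
move=> s0 st sumt null.
(* With this epsilon, (1 + epsilon) s = t. *)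
have eps0 : 0 < t / s - 1 by rewrite subr_gt0 ltr_pdivlMr// mul1r.
have [c c0 f_exp] := regular_expansion f_iIFS f_regular eps0.
pose r n := c / xi n `^ (1 + (t / s - 1)).
have r0 n : 0 <= r n by rewrite /r divr_ge0 ?powR_ge0// ltW.
have r_gt0 n : (1 <= n)%N -> 0 < r n by move=> n1; rewrite divr_gt0// powR_gt0// xi_gt0.
have rs n : r n `^ s = c `^ s * (1 / xi n `^ t).
  rewrite /r powRM ?invr_ge0 ?powR_ge0 ?(ltW c0)// -powRN -powRrM.
  by rewrite mul1r -powRN; congr (_ * _ `^ _); field; rewrite gt_eqF.
have /choice[B BP] j : exists t, [/\ uniq t, forall i, i \in t -> D i /\ (j <= i)%N &
    2 <= \sum_(i <- t) r i `^ s].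
  have [|u [uu uD uM]] := divergent_block (2 / c `^ s) j _ sumt.
    by move=> n; rewrite divr_ge0// powR_ge0.
  exists u; split=> //; under eq_bigr do rewrite rs.
  by rewrite -mulr_sumr -ler_pdivrMl ?powR_gt0// mulrC.
have D0 : D !=set0 by exact: infinite_setN0.
have Dm := minN_in D0.
have [J [Joo JB]] : exists J : nat -> nat, J n @[n --> \oo] --> \oo /\
    forall n, (0 < J n)%N -> forall i, i \in B (J n) -> i%:R <= phi n /\ 2^-1 ^+ n <= r i.
  apply: (@slow_index (fun j n => forall i, i \in B j -> i%:R <= phi n /\ 2^-1 ^+ n <= r i)).
  move=> j; apply: near_all_seq => i iB.
  have [_ BD _] := BP j; have ri := r_gt0 _ (D_pos (BD i iB).1).
  have n1 : \forall n \near \oo, i%:R <= phi n by move/cvgryPge : phi_cvg; exact.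
  have n2 : \forall n \near \oo, 2^-1 ^+ n <= r i.
    have : 2^-1 ^+ n @[n --> \oo] --> (0 : R).
      by apply: cvg_expr; rewrite ger0_norm ?invf_lt1 ?invr_ge0 ?ltr1n.
    move=> /cvgrPdist_lt/(_ _ ri); apply: filterS => n.
    by rewrite sub0r normrN ger0_norm ?exprn_ge0 ?invr_ge0// => /ltW.
  by apply: filterS2 n1 n2 => n.
(* Before the blocks become usable the only digit is [minN D], which [phi_ge] allows at every
   level. *)
pose A n := if J n == 0%N then [:: minN D] else B (J n).
have AD n i : i \in A n -> [/\ D i & (J n <= i)%N].
  rewrite /A; case: eqP => [->|_ iB]; first by rewrite inE => /eqP ->.
  by have [_ BD _] := BP (J n); have [] := BD i iB.
have A_gt0 n i : (1 <= n)%N -> i \in A n -> (1 <= i)%N by move=> _ /AD[/D_pos].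
have A_uniq n : (1 <= n)%N -> uniq (A n).
  by move=> _; rewrite /A; case: ifP => // _; have [] := BP (J n).
have Z_gt0 n : (1 <= n)%N -> 0 < level_sum A r s n.
  move=> _; rewrite /level_sum /A; case: ifP => _.
    by rewrite big_seq1 powR_gt0// r_gt0// D_pos.
  by have [_ _] := BP (J n); apply: lt_le_trans.
(* Once [J] is positive each level divides by a sum at least 2, so this normalised weight stops
   growing. *)
pose G n := level_weight A r s n * 2 ^+ n.
have [N _ JN] : \forall n \near \oo, (0 < J n)%N by move/cvgnyPge : Joo; exact.
have GS n : G n.+1 = G n * (2 / level_sum A r s n.+1).
  rewrite /G /level_weight [in LHS]big_nat_recr//= exprS; ring.
have G0 n : 0 <= G n.
  elim: n => [|n IH]; first by rewrite /G /level_weight big_geq// mul1r.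
  by rewrite GS mulr_ge0// divr_ge0// ltW// Z_gt0.
have [M M0 GM] : exists2 M, 0 <= M & forall n, G n <= M.
  apply: (@eventually_nonincreasing_bounded _ _ N) => // n Nn.
  rewrite GS ler_piMr// ler_pdivrMr ?Z_gt0// mul1r /level_sum /A.
  have /lt0n_neq0/negbTE -> := JN n.+1 (leqW Nn).
  by have [] := BP (J n.+1).
have WM n : level_weight A r s n <= M * 2^-1 ^+ n.
  by rewrite exprVn ler_pdivlMr ?exprn_gt0//; exact: GM.
(* The summand 1 serves the block levels, where [r i] is at least 2^-n; the inverse serves the
   levels whose only digit is [minN D]. *)
pose C := M * (1 + (r (minN D))^-1).
have rm := r_gt0 _ (D_pos Dm).
have C0 : 0 <= C by rewrite mulr_ge0// addr_ge0// invr_ge0.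
have weight_le n i : (1 <= n)%N -> i \in A n -> level_weight A r s n <= C * r i.
  move=> n1; rewrite /A; case: ifP => Jn.
    rewrite inE => /eqP ->; apply: le_trans (WM n) _.
    rewrite /C -mulrA ler_wpM2l// mulrDl mul1r mulVf ?gt_eqF//.
    apply: (@le_trans _ _ 1); last by rewrite lerDr.
    by rewrite exprn_ile1 ?invr_ge0// invf_le1 ?ler1n.
  move=> iB; have [|_ ri] := JB n _ i iB; first by rewrite lt0n Jn.
  apply: le_trans (WM n) _; rewrite /C -mulrA ler_wpM2l//.
  by apply: le_trans ri _; rewrite mulrDl mul1r lerDl mulr_ge0// invr_ge0.
apply: (not_null_of_weights f_iIFS f_crit f_exp C0 r0 s0 A_uniq A_gt0 Z_gt0 weight_le).
move=> e e0.
(* Enumerates the points f_w(0) and f_w(1), the only ones where the chosen coding may differ from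
   [u]. *)
pose p m := if (unpickle m : option (seq nat * bool)) is Some wb
  then compw f wb.1 wb.2%:R else 0.
have eE : (e%:E = (e / 2)%:E + (e / 2)%:E)%E by rewrite -EFinD; congr EFin; lra.
have e2 : 0 < e / 2 by rewrite divr_gt0.
apply: (@covers_le _ _ _ _ (S_set f a D phi `|` range p) ((e / 2)%:E + (e / 2)%:E)%E);
  last by apply: covers_setU; rewrite ?lee_fin ?(ltW e2)//;
    [exact: null|apply: covers_countable => //; exact: ltW].
  move=> _ [u uA <-].
  have u1 : digit_seq u by move=> n n1; exact: A_gt0 (uA n n1).
  have xA : attractor f (nat_proj f u) by exists u.
  have [ax1 axE] := a_digits xA.
  have [ua|[w [b E]]] := nat_proj_inj f_iIFS f_crit u1 ax1 (esym axE); last first.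
    by right; exists (pickle (w, b)) => //; rewrite /p pickleK.
  left; split; first split=> //.
  - by move=> n n1; rewrite -ua//; have [] := AD _ _ (uA n n1).
  - apply/cvgnyPge => m; have n1 : \forall n \near \oo, (m <= J n)%N by move/cvgnyPge : Joo; exact.
    have n2 : \forall n \near \oo, (1 <= n)%N by exact: nbhs_infty_ge.
    apply: filterS2 n1 n2 => n mJ n1; rewrite -ua//.
    by have [_] := AD _ _ (uA n n1); exact: leq_trans.
  - move=> n n1; rewrite -ua//; have := uA n n1; rewrite /A; case: ifP => Jn.
      by rewrite inE => /eqP ->; exact: phi_ge.
    by move=> uB; have [] := JB n _ _ uB; rewrite ?lt0n ?Jn.
by rewrite eE.
Qed.

Lemma hausdorff_dim_le_s0 : (hausdorff_dim (S_set f a D phi) <= s0 D xi)%E.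
Proof.
apply: le_ereal_inf_tmp => _ [t [t0 sumt] <-].
apply/lee_addgt0Pr => e e0; apply: ereal_inf_lbound.
exists (t + e) => //; split; first by rewrite addr_ge0// ltW.
apply/hausdorff_measure_eq0P => d h d0 h0.
apply: covers_le (E_set_null t0 _ sumt d0 h0) => //; first by move=> x [].
by rewrite ltrDl.
Qed.

Lemma s0_le_hausdorff_dim : (s0 D xi <= hausdorff_dim (S_set f a D phi))%E.
Proof.
apply: le_ereal_inf_tmp => _ [s [s_ge0 /hausdorff_measure_eq0P null] <-].
rewrite leNgt; apply/negP => ss0.
(* [s0 D xi] may be infinite, in which case [s + 1] is taken. *)
have [t st ts0] : exists2 t, s < t & (t%:E < s0 D xi)%E.
  case: (s0 D xi) ss0 => [z|_|//].
    by rewrite lte_fin => sz; exists ((s + z) / 2); rewrite ?lte_fin; lra.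
  by exists (s + 1); rewrite ?ltry// ltrDl.
have sumt : (\esum_(n in D) (1 / xi n `^ t)%:E = +oo)%E.
  apply/eqP; rewrite -leye_eq leNgt; apply/negP => sumt.
  move: ts0; apply/negP; rewrite -leNgt; apply: ereal_inf_lbound.
  by exists t => //; split=> //; rewrite ltW// (le_lt_trans s_ge0).
(* The midpoint is positive even if [s = 0], and nullity at [s] passes up to it. *)
apply: (@S_set_not_null ((s + t) / 2) t _ _ sumt); [lra|lra|].
move=> e e0; apply: covers_exponent (null 1 e ltr01 e0) => //.
by apply/andP; split=> //; lra.
Qed.

End Dimension.

Theorem theorem1p2 (R : realType) (f : nat -> R -> R) (xi : nat -> R)
    (a : R -> nat -> nat)
    (f_iIFS : iIFS f)
    (xi_gt0 : forall n : nat, (1 <= n)%N -> 0 < xi n)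
    (f_regular : xi_regular xi f)
    (f_bdp : bounded_distortion f)
    (a_digits : digits_of f a)
    (D : set nat)
    (D_pos : forall n : nat, D n -> (1 <= n)%N)
    (D_infinite : infinite_set D)
    (phi : nat -> R)
    (phi_ge : forall n : nat, (1 <= n)%N -> (minN D)%:R <= phi n)
    (phi_cvg : phi n @[n --> \oo] --> +oo) :
  hausdorff_dim (S_set f a D phi) = s0 D xi.
Proof.
apply/eqP; rewrite eq_le hausdorff_dim_le_s0//=.
exact: s0_le_hausdorff_dim.
Qed.
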